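(* Let $\mathcal{K}$ be an $\infty$-cosmos. For any pair of parallel functors $f,g\colon A\to B$ in $\mathcal{K}$ there are natural bijections between the following: 2-cells $f\Rightarrow g$ in the homotopy 2-category $\mathcal{K}_2$; cells in $\mathrm{Mod}_{\mathcal{K}}$ from $B\downarrow f\colon A\nrightarrow B$ to $B\downarrow g\colon A\nrightarrow B$ with identity vertical boundaries; cells in $\mathrm{Mod}_{\mathcal{K}}$ from $A^{\mathbf 2}\colon A\nrightarrow A$ to $B^{\mathbf 2}\colon B\nrightarrow B$ with left vertical boundary $g$ and right vertical boundary $f$; and cells in $\mathrm{Mod}_{\mathcal{K}}$ from $g\downarrow B\colon B\nrightarrow A$ to $f\downarrow B\colon B\nrightarrow A$ with identity vertical boundaries.
   Context: An $\infty$-cosmos (with all objects cofibrant) is a simplicially enriched category $\mathcal{K}$ whose mapping spaces $\mathrm{map}(A,B)$ are quasi-categories, equipped with a subcategory of isofibrations (written $\twoheadrightarrow$), such that: (a) $\mathcal{K}$ has, in the simplicially enriched sense, a terminal object $1$, cotensors $U\pitchfork A$ of every object $A$ by every finitely presented simplicial set $U$, and pullbacks of isofibrations along arbitrary morphisms (''simplicial pullbacks''); (b) isofibrations include all isomorphisms and all maps $A\to 1$, are stable under pullback, for every isofibration $p\colon E\twoheadrightarrow B$ and inclusion $U\hookrightarrow V$ of finitely presented simplicial sets the induced map $V\pitchfork E\to (U\pitchfork E)\times_{U\pitchfork B}(V\pitchfork B)$ is an isofibration, and $\mathrm{map}(X,p)$ is an isofibration of quasi-categories for every object $X$; (c) every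 object has the left lifting property with respect to trivial fibrations. Here $f$ is an equivalence if $\mathrm{map}(X,f)$ is an equivalence of quasi-categories for all $X$, and a trivial fibration if it is an isofibration and an equivalence. Objects of $\mathcal{K}$ are called $\infty$-categories and its morphisms functors. The homotopy 2-category $\mathcal{K}_2$ has the same objects and 1-cells, with $\hom(A,B)$ the homotopy category of $\mathrm{map}(A,B)$. Commas. For functors $f\colon B\to A$, $g\colon C\to A$, the comma $\infty$-category $f\downarrow g$ is the simplicial pullback of $(p_1,p_0)\colon\Delta^1\pitchfork A\twoheadrightarrow A\times A$ (evaluation at $1$ and $0$) along $g\times f\colon C\times B\to A\times A$; it carries an isofibration $(p_1,p_0)\colon f\downarrow g\twoheadrightarrow C\times B$ and a canonical 2-cell $\phi\colon fp_0\Rightarrow gp_1$. Write $A\downarrow g$ or $f\downarrow A$ when the other functor is $\mathrm{id}_A$, and $A^{\mathbf 2}=\Delta^1\pitchfork A$ when both are. Each $f\downarrow g$ is a module $C\nrightarrow B$; in general, a module $A\nrightarrow B$ is an isofibration $(q,p)\colon E\twoheadrightarrow A\times B$ that is a cartesian fibration in the homotopy 2-category of the sliced $\infty$-cosmos $\mathcal{K}/A$, a cocartesian fibration in that of $\mathcal{K}/B$, and a groupoidal object of $\mathcal{K}/(A\times B)$ (only the comma modules listed in the claim are needed here). Unary cells in $\mathrm{Mod}_{\mathcal{K}}$ (the virtual double category of modules): a cell from a module $(q,p)\colon E\twoheadrightarrow A\times B$ to a module $(s,r)\colon F\twoheadrightarrow C\times D$ with left vertical boundary $u\colon A\to C$ and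 right vertical boundary $v\colon B\to D$ is an isomorphism class of objects in the quasi-category given by the fibre of $\mathrm{map}(E,(s,r))\colon\mathrm{map}(E,F)\to\mathrm{map}(E,C\times D)$ over $(uq,vp)$, i.e. an isomorphism class of functors $e\colon E\to F$ with $se=uq$ and $re=vp$. *)

(* Defs.v *)
From mathcomp Require Import all_boot.
From mathcomp Require Import boolp.
From Stdlib Require Import Relations.

Set Implicit Arguments.
Unset Strict Implicit.
Unset Printing Implicit Defensive.

(** [mono m n] is the set of arrows [m] -> [n] of the simplex category. *)
Record mono (m n : nat) := Mono {
  mono_fun :> {ffun 'I_m.+1 -> 'I_n.+1};
  mono_le : [forall i : 'I_m.+1, forall j : 'I_m.+1, (i <= j) ==> (mono_fun i <= mono_fun j)] }.

Lemma mono_ext m n (f g : mono m n) : (forall i, f i = g i) -> f = g.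
Proof.
case: f g => [f fP] [g gP] /= /ffunP fg; subst g.
by rewrite (bool_irrelevance fP gP).
Qed.

Lemma mono_leP m n (f : 'I_m.+1 -> 'I_n.+1) :
  (forall i j : 'I_m.+1, i <= j -> f i <= f j) ->
  [forall i : 'I_m.+1, forall j : 'I_m.+1,
    (i <= j) ==> ([ffun k => f k] i <= [ffun k => f k] j)].
Proof.
by move=> h; apply/forallP => i; apply/forallP => j; apply/implyP; rewrite !ffunE; exact: h.
Qed.

Definition mono_of m n (f : 'I_m.+1 -> 'I_n.+1)
    (h : forall i j : 'I_m.+1, i <= j -> f i <= f j) : mono m n :=
  Mono (mono_leP h).

Lemma mono_homo m n (f : mono m n) (i j : 'I_m.+1) : i <= j -> f i <= f j.
Proof. by move=> ij; have /forallP/(_ i)/forallP/(_ j)/implyP := mono_le f; apply. Qed.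

Definition mono_id n : mono n n := @mono_of n n (fun i => i) (fun _ _ h => h).

Definition mono_comp m n p (f : mono n p) (g : mono m n) : mono m p :=
  @mono_of m p (fun i => f (g i)) (fun _ _ h => mono_homo f (mono_homo g h)).

Definition mono_cst m n (k : 'I_n.+1) : mono m n :=
  @mono_of m n (fun=> k) (fun _ _ _ => leqnn k).

Lemma coface_subproof n (i : nat) (k : 'I_n.+1) : bump i k < n.+2.
Proof. by rewrite /bump; case: (i <= k); rewrite ?add1n ?add0n !ltnS ?leq_ord // ltnW. Qed.

Lemma coface_homo n (i : nat) (j k : 'I_n.+1) : j <= k ->
  Ordinal (coface_subproof i j) <= Ordinal (coface_subproof i k).
Proof. by move=> jk /=; rewrite leq_bump2. Qed.

(** The coface omitting the value [i]; meaningful for [i <= n.+1]. *)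
Definition coface n (i : nat) : mono n n.+1 := mono_of (@coface_homo n i).

Record sset := SSet {
  simp :> nat -> Type;
  act : forall m n, mono m n -> simp n -> simp m;
  act_id : forall n (x : simp n), act (mono_id n) x = x;
  act_comp : forall m n p (f : mono n p) (g : mono m n) (x : simp p),
    act (mono_comp f g) x = act g (act f x) }.

Definition face (X : sset) n (i : nat) (x : X n.+1) : X n := act (coface n i) x.

(** The totally degenerate simplex on a vertex. *)
Definition degen (X : sset) n (x : X 0) : X n := act (mono_cst n ord0) x.

Record smap (X Y : sset) := SMap {
  smap_fun :> forall n, X n -> Y n;
  smap_act : forall m n (f : mono m n) (x : X n),
    smap_fun (act f x) = act f (smap_fun x) }.

Definition inclusion (X Y : sset) (F : smap X Y) := forall n, injective (@smap_fun _ _ F n).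

Definition Delta (n : nat) : sset.
Proof.
refine (@SSet (fun m => mono m n) (fun m p f x => mono_comp x f) _ _).
- by move=> m x; apply: mono_ext => i; rewrite !ffunE.
- by move=> m p q f g x; apply: mono_ext => i; rewrite !ffunE.
Defined.

Definition sprod (X Y : sset) : sset.
Proof.
refine (@SSet (fun n => X n * Y n)%type
              (fun m n f z => (act f z.1, act f z.2)) _ _).
- by move=> n [x y]; rewrite !act_id.
- by move=> m n p f g [x y]; rewrite !act_comp.
Defined.

Definition ssub (X : sset) (P : forall n, X n -> Prop)
    (Pact : forall m n (f : mono m n) (x : X n), P n x -> P m (act f x)) : sset.
Proof.
refine (@SSet (fun n => {x : X n | P n x})
  (fun m n f x => exist _ (act f (sval x)) (Pact m n f _ (svalP x))) _ _).
- by move=> n [x Px]; apply: eq_exist; rewrite act_id.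
- by move=> m n p f g [x Px]; apply: eq_exist; rewrite /= act_comp.
Defined.

Definition ssub_incl (X : sset) P Pact : smap (@ssub X P Pact) X :=
  @SMap (@ssub X P Pact) X (fun n x => sval x) (fun _ _ _ _ => erefl).

(** The [k]-th horn: the union of the faces of [Delta n] containing the vertex [k],
    i.e. the simplices omitting some vertex other than [k]. *)
Definition in_horn n (k : 'I_n.+1) m (x : Delta n m) : Prop :=
  exists j : 'I_n.+1, j != k /\ forall i, (x : mono m n) i != j.

Lemma in_horn_act n (k : 'I_n.+1) m p (f : mono m p) (x : Delta n p) :
  in_horn k x -> in_horn k (act f x).
Proof. by case=> j [jk xj]; exists j; split => // i; rewrite ffunE. Qed.

Definition horn n (k : 'I_n.+1) : sset := ssub (@in_horn_act n k).
Definition horn_incl n (k : 'I_n.+1) : smap (horn k) (Delta n) :=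
  ssub_incl (@in_horn_act n k).

Definition quasicategory (X : sset) : Prop :=
  forall n (k : 'I_n.+1), 0 < k < n -> forall h : smap (horn k) X,
  exists s : smap (Delta n) X, forall m (x : horn k m), s m (horn_incl k m x) = h m x.

Definition has_rlp (U V X Y : sset) (i : smap U V) (p : smap X Y) : Prop :=
  forall (u : smap U X) (v : smap V Y),
  (forall n (x : U n), p n (u n x) = v n (i n x)) ->
  exists w : smap V X, (forall n (x : U n), w n (i n x) = u n x)
                    /\ (forall n (y : V n), p n (w n y) = v n y).

(** The nerve of the free-living isomorphism (the contractible groupoid on two objects):
    an [n]-simplex is any sequence of [n.+1] objects. *)
Definition Jiso : sset.
Proof.
refine (@SSet (fun n => {ffun 'I_n.+1 -> bool})
              (fun m n f x => [ffun i => x (f i)]) _ _).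
- by move=> n x; apply/ffunP => i; rewrite !ffunE.
- by move=> m n p f g x; apply/ffunP => i; rewrite !ffunE.
Defined.

Definition Jobj (b : bool) n : Jiso n := [ffun=> b].

Definition Jpoint : smap (Delta 0) Jiso.
Proof.
refine (@SMap (Delta 0) Jiso (fun n _ => Jobj false n) _).
by move=> m n f x; apply/ffunP => i; rewrite !ffunE.
Defined.

Definition qc_isofibration (X Y : sset) (p : smap X Y) : Prop :=
  (forall n (k : 'I_n.+1), 0 < k < n -> has_rlp (horn_incl k) p)
  /\ has_rlp Jpoint p.

Definition qc_equivalence (X Y : sset) (f : smap X Y) : Prop :=
  exists (g : smap Y X) (H : smap (sprod X Jiso) X) (H' : smap (sprod Y Jiso) Y),
    [/\ forall n (x : X n), H n (x, Jobj false n) = x,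
        forall n (x : X n), H n (x, Jobj true n) = g n (f n x),
        forall n (y : Y n), H' n (y, Jobj false n) = f n (g n y)
      & forall n (y : Y n), H' n (y, Jobj true n) = y].

(** Finite presentability, by finitely many generating simplices [x i] and finitely many
    relations [a_j^* x_(l j) = b_j^* x_(r j)]; equivalently, by the Yoneda lemma, [U] is a
    coequaliser of two maps between finite coproducts of standard simplices. *)
Definition finitely_presented (U : sset) : Prop :=
  exists (I J : finType) (d : I -> nat) (x : forall i, U (d i))
         (e : J -> nat) (l r : J -> I)
         (a : forall j, mono (e j) (d (l j))) (b : forall j, mono (e j) (d (r j))),
    (forall j, act (a j) (x (l j)) = act (b j) (x (r j))) /\
    forall (X : sset) (y : forall i, X (d i)),
      (forall j, act (a j) (y (l j)) = act (b j) (y (r j))) ->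
      exists F : smap U X, (forall i, F _ (x i) = y i) /\
        forall G : smap U X, (forall i, G _ (x i) = y i) ->
          forall n (u : U n), G n u = F n u.

Definition fibre (X Y : sset) (F : smap X Y) (y : Y 0) : sset.
Proof.
refine (@ssub X (fun n x => F n x = degen n y) _).
move=> m n f x /= Fx; rewrite smap_act Fx /degen -act_comp; congr act.
by apply: mono_ext => i; rewrite !ffunE.
Defined.

(** The quotient of [T] by the equivalence relation generated by [R]. *)
Definition quot (T : Type) (R : relation T) : Type :=
  {P : T -> Prop | exists x, P = clos_refl_sym_trans T R x}.

(** For a quotient of a subtype of [T]: the class [q] contains [t]. *)
Definition represents (T : Type) (P : T -> Prop) (R : relation {t | P t})
    (q : quot R) (t : T) : Prop :=
  exists Pt : P t, sval q (exist _ t Pt).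

(** [edge x y] consists of the 1-simplices from [x] to [y]. *)
Definition edge (X : sset) (x y : X 0) : Type :=
  {a : X 1 | face 1 a = x /\ face 0 a = y}.

(** In the homotopy category of a quasi-category, [c] is the composite of [a] followed
    by [b] precisely when some 2-simplex has boundary as below. *)
Definition composite (X : sset) (a b c : X 1) : Prop :=
  exists s : X 2, [/\ face 2 s = a, face 0 s = b & face 1 s = c].

Definition homotopic (X : sset) (x y : X 0) : relation (edge x y) :=
  fun a b => composite (sval a) (degen 1 y) (sval b).

(** The hom-sets of the homotopy category of a quasi-category. *)
Definition ho_hom (X : sset) (x y : X 0) : Type := quot (@homotopic X x y).

Definition isomorphic (X : sset) : relation (X 0) :=
  fun x y => exists (a : edge x y) (b : edge y x),
    composite (sval a) (sval b) (degen 1 x) /\ composite (sval b) (sval a) (degen 1 y).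

Definition iso_class (X : sset) : Type := quot (@isomorphic X).

Record scat := SCat {
  ob :> Type;
  Map : ob -> ob -> sset;
  kcomp : forall A B C n, Map B C n -> Map A B n -> Map A C n;
  idf : forall A, Map A A 0;
  comp_act : forall A B C m n (f : mono m n) (b : Map B C n) (a : Map A B n),
    act f (kcomp b a) = kcomp (act f b) (act f a);
  compA : forall A B C D n (c : Map C D n) (b : Map B C n) (a : Map A B n),
    kcomp c (kcomp b a) = kcomp (kcomp c b) a;
  comp_idl : forall A B n (a : Map A B n), kcomp (degen n (idf B)) a = a;
  comp_idr : forall A B n (a : Map A B n), kcomp a (degen n (idf A)) = a }.

Arguments Map {_} _ _.
Arguments kcomp {_ _ _ _ n} _ _.
Arguments idf {_} A.

Section SimplicialCategory.
Variable K : scat.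
Implicit Types A B C E X : K.

Definition functor A B : Type := Map A B 0.

Definition is_iso A B (f : functor A B) : Prop :=
  exists g : functor B A, kcomp g f = idf A /\ kcomp f g = idf B.

(** Whiskering of an [n]-simplex by a functor, on either side. *)
Definition whl A B C n (f : functor B C) (a : Map A B n) : Map A C n :=
  kcomp (degen n f) a.
Definition whr A B C n (b : Map B C n) (f : functor A B) : Map A C n :=
  kcomp b (degen n f).

Lemma act_degen (X : sset) m n (f : mono m n) (x : X 0) : act f (degen n x) = degen m x.
Proof. by rewrite /degen -act_comp; congr act; apply: mono_ext => i; rewrite !ffunE. Qed.

Lemma whl_act A B C m n (t : mono m n) (f : functor B C) (a : Map A B n) :
  whl f (act t a) = act t (whl f a).
Proof. by rewrite /whl comp_act act_degen. Qed.

Lemma whr_act A B C m n (t : mono m n) (b : Map B C n) (f : functor A B) :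
  whr (act t b) f = act t (whr b f).
Proof. by rewrite /whr comp_act act_degen. Qed.

(** [map(X, f)]. *)
Definition postcomp X A B (f : functor A B) : smap (Map X A) (Map X B) :=
  @SMap (Map X A) (Map X B) (fun n a => whl f a) (fun m n t a => whl_act t f a).

Definition cos_equivalence A B (f : functor A B) : Prop :=
  forall X, qc_equivalence (postcomp X f).

(** Enriched universal property: [map(X, 1)] is the terminal simplicial set. *)
Record terminal := Terminal {
  term_ob : K;
  term_map : forall X n, Map X term_ob n;
  term_uniq : forall X n (a b : Map X term_ob n), a = b }.

(** Simplicial pullback: [map(X, P)] is the pullback of [map(X, E)] and [map(X, C)]
    over [map(X, B)], naturally in [X]. *)
Record pullback E B C (p : functor E B) (f : functor C B) := Pullback {
  pb_ob : K;
  pb_fst : functor pb_ob E;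
  pb_snd : functor pb_ob C;
  pb_comm : kcomp p pb_fst = kcomp f pb_snd;
  pb_lift : forall X n (a : Map X E n) (b : Map X C n),
    whl p a = whl f b -> Map X pb_ob n;
  pb_liftl : forall X n (a : Map X E n) (b : Map X C n) (h : whl p a = whl f b),
    whl pb_fst (pb_lift h) = a;
  pb_liftr : forall X n (a : Map X E n) (b : Map X C n) (h : whl p a = whl f b),
    whl pb_snd (pb_lift h) = b;
  pb_uniq : forall X n (c c' : Map X pb_ob n),
    whl pb_fst c = whl pb_fst c' -> whl pb_snd c = whl pb_snd c' -> c = c' }.

(** Simplicial cotensor of [A] by [U]: composition with the universal
    [U -> map(cot_ob, A)] identifies the [n]-simplices of [map(X, cot_ob)] with the maps
    [U * Delta n -> map(X, A)], i.e. with the [n]-simplices of [map(X, A)^U]. *)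
Record cotensor (U : sset) A := Cotensor {
  cot_ob : K;
  cot_ev : smap U (Map cot_ob A);
  cot_lift : forall X n, smap (sprod U (Delta n)) (Map X A) -> Map X cot_ob n;
  cot_liftE : forall X n (F : smap (sprod U (Delta n)) (Map X A)) m (u : U m) (t : mono m n),
    kcomp (cot_ev m u) (act t (cot_lift F)) = F m (u, t);
  cot_uniq : forall X n (c c' : Map X cot_ob n),
    (forall m (u : U m) (t : mono m n),
       kcomp (cot_ev m u) (act t c) = kcomp (cot_ev m u) (act t c')) -> c = c' }.

Definition cot_transpose (U : sset) X A (F : smap U (Map X A)) :
  smap (sprod U (Delta 0)) (Map X A) :=
  @SMap (sprod U (Delta 0)) (Map X A) (fun n z => F n z.1)
    (fun m n t z => smap_act F t z.1).

(** The functor [U -o p : U -o E -> U -o B]. *)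
Definition cot_map (U : sset) E B (cE : cotensor U E) (cB : cotensor U B)
    (p : functor E B) : functor (cot_ob cE) (cot_ob cB).
Proof.
refine (cot_lift cB (cot_transpose (@SMap U (Map (cot_ob cE) B)
  (fun n u => whl p (cot_ev cE n u)) _))).
by move=> m n t u; rewrite smap_act whl_act.
Defined.

(** The functor [V -o A -> U -o A] restricting along [i : U -> V]. *)
Definition cot_res (U V : sset) A (cV : cotensor V A) (cU : cotensor U A)
    (i : smap U V) : functor (cot_ob cV) (cot_ob cU).
Proof.
refine (cot_lift cU (cot_transpose (@SMap U (Map (cot_ob cV) A)
  (fun n u => cot_ev cV n (i n u)) _))).
by move=> m n t u; rewrite !smap_act.
Defined.

End SimplicialCategory.

Arguments functor {K}.

(** In [isofib_cot], [P] ranges over all pullbacks because [U -o p] is not yet known to be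
    an isofibration; the case of empty [U] shows that it is one, so such [P] exist. *)
Record cosmos := Cosmos {
  cos_cat :> scat;
  map_qcat : forall A B : cos_cat, quasicategory (Map A B);
  isofib : forall A B : cos_cat, functor A B -> Prop;
  isofib_comp : forall (A B C : cos_cat) (g : functor B C) (f : functor A B),
    isofib g -> isofib f -> isofib (kcomp g f);
  one : terminal cos_cat;
  cot : forall U : sset, finitely_presented U -> forall A : cos_cat, cotensor U A;
  pb : forall (E B C : cos_cat) (p : functor E B), isofib p ->
    forall f : functor C B, pullback p f;
  isofib_iso : forall (A B : cos_cat) (f : functor A B), is_iso f -> isofib f;
  isofib_one : forall A : cos_cat, isofib (term_map one A 0);
  isofib_pb : forall (E B C : cos_cat) (p : functor E B) (f : functor C B)
    (P : pullback p f), isofib p -> isofib (pb_snd P);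
  isofib_cot : forall (E B : cos_cat) (p : functor E B) (U V : sset)
    (fU : finitely_presented U) (fV : finitely_presented V) (i : smap U V)
    (P : pullback (cot_map (cot fU E) (cot fU B) p) (cot_res (cot fV B) (cot fU B) i))
    (k : functor (cot_ob (cot fV E)) (pb_ob P)),
    isofib p -> inclusion i ->
    kcomp (pb_fst P) k = cot_res (cot fV E) (cot fU E) i ->
    kcomp (pb_snd P) k = cot_map (cot fV E) (cot fV B) p ->
    isofib k;
  isofib_map : forall (X E B : cos_cat) (p : functor E B),
    isofib p -> qc_isofibration (postcomp X p);
  cofibrant : forall (X E B : cos_cat) (p : functor E B) (b : functor X B),
    isofib p -> cos_equivalence p -> exists e : functor X E, kcomp p e = b }.

Arguments isofib {_ _ _}.

Lemma degen0 (X : sset) (x : X 0) : degen 0 x = x.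
Proof.
rewrite -[RHS]act_id; congr act; apply: mono_ext => i.
by rewrite !ffunE [i]ord1.
Qed.

Lemma whl0 (K : scat) (A B C : K) (f : functor B C) (a : Map A B 0) : whl f a = kcomp f a.
Proof. by rewrite /whl degen0. Qed.

Lemma fp_Delta n : finitely_presented (Delta n).
Proof.
exists unit, void, (fun=> n), (fun=> mono_id n), (fun=> 0).
exists (fun v : void => match v with end), (fun v : void => match v with end).
exists (fun v : void => match v with end), (fun v : void => match v with end).
split=> [[]|X y _].
have F_act m p (f : mono m p) (x : Delta n p) : 
    act (act f x : mono m n) (y tt) = act f (act (x : mono p n) (y tt)).
  by rewrite -act_comp.
exists (@SMap (Delta n) X (fun m x => act (x : mono m n) (y tt)) F_act); split=> [[]|G Gy m x] /=.
  by rewrite act_id.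
by rewrite -Gy -smap_act; congr (G m _); apply: mono_ext => i; rewrite !ffunE.
Qed.

Section Cosmos.
Variable K : cosmos.
Implicit Types A B C D X : K.

Definition cprodP A B : pullback (term_map (one K) A 0) (term_map (one K) B 0) :=
  pb (isofib_one A) (term_map (one K) B 0).
Definition cprod A B : K := pb_ob (cprodP A B).
Definition pr1 A B : functor (cprod A B) A := pb_fst (cprodP A B).
Definition pr2 A B : functor (cprod A B) B := pb_snd (cprodP A B).
Definition cpair X A B (a : functor X A) (b : functor X B) : functor X (cprod A B) :=
  pb_lift (p := term_map (one K) A 0) (cprodP A B)
    (term_uniq (whl (term_map (one K) A 0) a) (whl (term_map (one K) B 0) b)).
Definition cprod_map A B C D (u : functor A C) (v : functor B D) :
    functor (cprod A B) (cprod C D) := cpair (kcomp u (pr1 A B)) (kcomp v (pr2 A B)).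

Definition arrowP A : cotensor (Delta 1) A := cot (fp_Delta 1) A.
Definition arrow A : K := cot_ob (arrowP A).

(** The generic 1-simplex of [map(arrow A, A)]. *)
Definition arrow_cell A : Map (arrow A) A 1 := cot_ev (arrowP A) 1 (mono_id 1).
Definition arrow_p0 A : functor (arrow A) A := cot_ev (arrowP A) 0 (mono_cst 0 ord0).
Definition arrow_p1 A : functor (arrow A) A := cot_ev (arrowP A) 0 (mono_cst 0 ord_max).
Definition arrow_leg A : functor (arrow A) (cprod A A) := cpair (arrow_p1 A) (arrow_p0 A).

Definition two_points : sset :=
  @SSet (fun=> bool) (fun _ _ _ b => b) (fun _ _ => erefl) (fun _ _ _ _ _ _ => erefl).

Definition endpoints : smap two_points (Delta 1).
Proof.
refine (@SMap two_points (Delta 1)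
  (fun n (b : bool) => mono_cst n (if b then ord_max else ord0)) _).
by move=> m n f b; apply: mono_ext => i; rewrite !ffunE.
Defined.

Lemma fp_two_points : finitely_presented two_points.
Proof.
exists bool, void, (fun=> 0), id, (fun=> 0).
exists (fun v : void => match v with end), (fun v : void => match v with end).
exists (fun v : void => match v with end), (fun v : void => match v with end).
split=> [[]|X y _].
exists (@SMap two_points X (fun n b => degen n (y b))
         (fun m n f b => esym (act_degen f (y b)))).
split=> [b|G Gy n b] /=; first exact: degen0.
by rewrite -Gy /degen -smap_act.
Qed.

Lemma endpoints_inclusion : inclusion endpoints.
Proof.
move=> n b c /(congr1 (fun f : mono n 1 => f ord0)); rewrite !ffunE.
by case: b c => [] [].
Qed.

Lemma cot_one_uniq U (fU : finitely_presented U) X n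
  (a b : Map X (cot_ob (cot fU (term_ob (one K)))) n) : a = b.
Proof. by apply: cot_uniq => m u t; apply: term_uniq. Qed.

Lemma whl_kcomp A B C D n (g : functor B C) (f : functor A B) (a : Map D A n) :
  whl (kcomp g f) a = whl g (whl f a).
Proof. by rewrite /whl compA /degen comp_act. Qed.

Lemma cot_ev_degen (U : sset) A (c : cotensor U A) m (u : U 0) :
  cot_ev c m (degen m u) = degen m (cot_ev c 0 u).
Proof. by rewrite /degen smap_act. Qed.

Lemma arrow_leg_isofib A : isofib (arrow_leg A).
Proof.
pose pr b : functor (cprod A A) A := if b then pr1 A A else pr2 A A.
pose ev b : functor (cot_ob (cot fp_two_points A)) A := cot_ev (cot fp_two_points A) 0 b.
have evE m (b : two_points m) : cot_ev (cot fp_two_points A) m b = degen m (ev b).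
  exact: (cot_ev_degen (cot fp_two_points A) m (b : two_points 0)).
have pr_act m n (t : mono m n) (b : two_points n) :
  degen m (pr b) = act t (degen n (pr b)) by rewrite act_degen.
pose fst : functor (cprod A A) (cot_ob (cot fp_two_points A)) :=
  cot_lift (cot fp_two_points A) (cot_transpose (@SMap two_points (Map (cprod A A) A)
    (fun n b => degen n (pr b)) pr_act)).
have fstE m (b : two_points m) : kcomp (cot_ev (cot fp_two_points A) m b) (degen m fst) = degen m (pr b).
  by rewrite /degen cot_liftE.
have ev_fst b : kcomp (ev b) fst = pr b.
  by have := fstE 0 b; rewrite !degen0.
have c1 U (fU : finitely_presented U) X : functor X (cot_ob (cot fU (term_ob (one K)))).
  refine (cot_lift _ (cot_transpose (@SMap U (Map X _) (fun n _ => term_map (one K) X n) _))).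
  by move=> *; apply: term_uniq.
pose pairn X n (a b : Map X A n) : Map X (cprod A A) n :=
  pb_lift (cprodP A A) (term_uniq (whl (term_map (one K) A 0) a)
                                  (whl (term_map (one K) A 0) b)).
have pr_pair X n (a b : Map X A n) i : whl (pr i) (pairn X n a b) = if i then a else b.
  by case: i; [apply: pb_liftl | apply: pb_liftr].
have comm : kcomp (cot_map (cot fp_two_points A) (cot fp_two_points (term_ob (one K))) (term_map (one K) A 0)) fst
    = kcomp (cot_res (cot (fp_Delta 1) (term_ob (one K)))
              (cot fp_two_points (term_ob (one K))) endpoints) (c1 _ (fp_Delta 1) (cprod A A)).
  exact: cot_one_uniq.
unshelve refine (@isofib_cot K A (term_ob (one K)) (term_map (one K) A 0)
  two_points (Delta 1) fp_two_points (fp_Delta 1) endpoints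
  (@Pullback K _ _ _ _ _ (cprod A A) fst (c1 _ _ _) comm
     (fun X n a _ _ => pairn X n (whl (ev true) a) (whl (ev false) a)) _ _ _)
  (arrow_leg A) _ _ _ _).
- move=> X n a b h; apply: cot_uniq => m u t.
  rewrite -whl_act evE -!/(whl _ _) -whl_kcomp ev_fst whl_act pr_pair.
  by rewrite -/(whl _ _) whl_act; case: u.
- by move=> X n a b h; apply: cot_one_uniq.
- move=> X n c c' h _; apply: (@pb_uniq _ _ _ _ _ _ (cprodP A A)).
    by change (whl (pr true) c = whl (pr true) c'); rewrite -ev_fst !whl_kcomp h.
  by change (whl (pr false) c = whl (pr false) c'); rewrite -ev_fst !whl_kcomp h.
- exact: isofib_one.
- exact: endpoints_inclusion.
- rewrite /=; apply: cot_uniq => m u t.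
  rewrite cot_liftE /= -whl0 -whl_act evE -!/(whl _ _) -whl_kcomp ev_fst whl_act.
  rewrite (pr_pair _ _ (arrow_p1 A) (arrow_p0 A) u).
  have -> : mono_cst m (if u then ord_max else ord0) =
     degen m (mono_cst 0 (if u then ord_max else ord0) : Delta 1 0) :> Delta 1 m.
    by apply: mono_ext => i; rewrite !ffunE.
  rewrite cot_ev_degen /degen.
  have -> : t = mono_cst m ord0 by apply: mono_ext => i; rewrite !ffunE !ord1.
  by case: u.
- exact: cot_one_uniq.
Qed.

(** For [f : B -> A] and [g : C -> A], the comma [f | g], with its isofibration
    [(p1, p0)] to [C * B] and its generic 1-simplex from [f p0] to [g p1]. *)
Section Comma.
Variables (A B C : K) (f : functor B A) (g : functor C A).

Definition commaP : pullback (arrow_leg A) (cprod_map g f) :=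
  pb (arrow_leg_isofib A) (cprod_map g f).
Definition comma : K := pb_ob commaP.
Definition comma_leg : functor comma (cprod C B) := pb_snd commaP.
Definition comma_p1 : functor comma C := kcomp (pr1 C B) comma_leg.
Definition comma_p0 : functor comma B := kcomp (pr2 C B) comma_leg.
Definition comma_cell : Map comma A 1 := whr (arrow_cell A) (pb_fst commaP).

Lemma comma_leg_isofib : isofib comma_leg.
Proof. exact: isofib_pb (arrow_leg_isofib A). Qed.
End Comma.

Record two_sided A B := TwoSided {
  ts_ob : K;
  ts_leg : functor ts_ob (cprod A B);
  ts_isofib : isofib ts_leg }.

Definition ts_comma A B C (f : functor B A) (g : functor C A) : two_sided C B :=
  TwoSided (comma_leg_isofib f g).

Definition ts_arrow A : two_sided A A := TwoSided (arrow_leg_isofib A).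

(** The fibre of [map(E, F) -> map(E, C * D)] over [(u q, v p)], where [(q, p)] is the
    leg of [E]. *)
Definition cell_fibre A B C D (u : functor A C) (v : functor B D)
    (E : two_sided A B) (F : two_sided C D) : sset :=
  fibre (postcomp (ts_ob E) (ts_leg F))
    (cpair (kcomp u (kcomp (pr1 A B) (ts_leg E))) (kcomp v (kcomp (pr2 A B) (ts_leg E)))).

(** Cells from [E] to [F] with left boundary [u] and right boundary [v]. *)
Definition cell A B C D (u : functor A C) (v : functor B D)
    (E : two_sided A B) (F : two_sided C D) : Type :=
  iso_class (cell_fibre u v E F).

(** The functor [e], which lies over [u] and [v], belongs to the isomorphism class [c]. *)
Definition cell_rep A B C D (u : functor A C) (v : functor B D)
    (E : two_sided A B) (F : two_sided C D) (c : cell u v E F)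
    (e : functor (ts_ob E) (ts_ob F)) : Prop :=
  represents c e.

(** 2-cells [f => g] of the homotopy 2-category. *)
Definition cell2 A B (f g : functor A B) : Type := @ho_hom (Map A B) f g.

(** The 1-simplex [a], which goes from [f] to [g], belongs to the homotopy class [t]. *)
Definition cell2_rep A B (f g : functor A B) (t : cell2 f g) (a : Map A B 1) : Prop :=
  represents t a.

End Cosmos.

(* Main.v *)
From mathcomp Require Import all_boot zify.
From mathcomp Require Import boolp.
From Stdlib Require Import Relations.
Require Import Defs.

(** A functor into a comma [f | g] over a fixed pair of legs is the same thing as an edge
    [f b -> g c] of the mapping quasi-category, by the strict universal property of the
    comma. Two such functors are isomorphic over their legs exactly when the two edges are
    homotopic ([isomorphic_closureP]). In one direction, a fibred edge unwinds to a square
    whose two vertical sides are degenerate. In the other, a homotopy is a 2-simplex whose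
    face 0 is degenerate; collapsing the prism [Delta 1 * Delta n] onto the simplex
    [Delta n.+1] turns it into a fibred edge, and a 3-simplex filling an inner horn into a
    fibred 2-simplex exhibiting a right inverse of that edge, hence an inverse. So a cell
    into a comma is a homotopy class of edges, that is, a 2-cell of the homotopy 2-category.

    The cells of the statement are thereby 2-cells [p0 => g p1] out of [B | f], or
    [f p0 => g p1] out of the arrow object of [A], or [f p0 => p1] out of [g | B]. They
    correspond to 2-cells [f => g] by transposition along an adjunction. The projection [p1]
    of [B | f] has a right adjoint [i], the functor classifying the identity of [f]; its
    counit is an identity and its unit [h : id => i p1] satisfies [p1 h = id] and
    [p0 h = phi], where [phi] is the comma 2-cell. Pasting [a : f => g] with [phi] (with
    [f phi] in the case of the arrow object) has the inverse
    [b |-> b i]: going round one way gives [a] because [phi i] is an identity, and the other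
    way gives [b] by the interchange law applied to [b] and [h]
    ([reflection_transposition]). The projection [p0] of [g | B] has dually a left adjoint
    ([coreflection_transposition]). The unit and counit exist strictly: they are the squares
    [max] and [min] on the comma cell.

    In both steps classes are matched through a relation between representatives, namely
    the composite 2-simplices of the second block of the statement, so that block and the
    functoriality of the third reduce to associativity of composition of edges. *)

Set Implicit Arguments.
Unset Strict Implicit.
Unset Printing Implicit Defensive.

(** * Filling inner horns *)

Lemma codegen_subproof n (j : nat) (i : 'I_n.+2) : minn (unbump j i) n < n.+1.
Proof. by rewrite ltnS geq_minr. Qed.

Lemma codegen_homo n (j : nat) (i k : 'I_n.+2) : i <= k ->
  Ordinal (codegen_subproof j i) <= Ordinal (codegen_subproof j k).
Proof. by move=> ik /=; rewrite /unbump; lia. Qed.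

Lemma ord_neq n (i j : 'I_n) : i != j -> i <> j :> nat.
Proof. by move/eqP => ij /val_inj. Qed.

(** The codegeneracy hitting [j] twice; the truncation by [n] makes it total in [j], and
    gives for [j = n.+1] a retraction of the last coface. *)
Definition codegen n (j : nat) : mono n.+1 n := mono_of (@codegen_homo n j).

Lemma coface_codegen m n (j : 'I_n.+2) (x : mono m n.+1) :
  (forall i, x i != j) ->
  mono_comp (coface n j) (mono_comp (codegen n j) x) = x.
Proof.
move=> xj; apply: mono_ext => i; apply: val_inj; rewrite !ffunE /=.
rewrite /bump /unbump.
by move: (ord_neq (xj i)) (ltn_ord j) (ltn_ord (x i)); lia.
Qed.

Lemma mono_compA m n p q (f : mono p q) (g : mono n p) (h : mono m n) :
  mono_comp f (mono_comp g h) = mono_comp (mono_comp f g) h.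
Proof. by apply: mono_ext => i; rewrite !ffunE. Qed.

(** A horn is glued from its faces. A simplex of the horn misses some vertex [j], hence
    factors through the face [j], by [coface_codegen]; when it misses two vertices it factors
    through their common face, where the matching condition makes both values agree. *)
Lemma inner_filler (X : sset) n (k : 'I_n.+3) (y : 'I_n.+3 -> X n.+1) :
  quasicategory X -> 0 < k < n.+2 ->
  (forall i j : 'I_n.+3, i != k -> j != k -> i < j ->
     face i (y j) = face j.-1 (y i)) ->
  exists w : X n.+2, forall j, j != k -> face j w = y j.
Proof.
move=> qX kn ycomp.
have agree m (x : mono m n.+2) (i j : 'I_n.+3) : i != k -> j != k -> i < j ->
    (forall l, x l != i) -> (forall l, x l != j) ->
    act (mono_comp (codegen n.+1 j) x) (y j) = act (mono_comp (codegen n.+1 i) x) (y i).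
  move=> ik jk ij xi xj.
  pose z : mono m n := mono_comp (codegen n i) (mono_comp (codegen n.+1 j) x).
  have zj : mono_comp (codegen n.+1 j) x = mono_comp (coface n i) z.
    have ilt : i < n.+2 by move: ij (ltn_ord j); clear; lia.
    rewrite -{1}(coface_codegen (j := Ordinal ilt) (x := mono_comp (codegen n.+1 j) x)) //.
    move=> l; rewrite !ffunE -(inj_eq val_inj) /= /unbump.
    have a (p q r N : nat) : p < q -> r <> p -> r <> q -> q < N.+3 -> r < N.+3 ->
      minn (r - (q < r)) N.+1 != p by lia.
    exact: a ij (ord_neq (xi l)) (ord_neq (xj l)) (ltn_ord j) (ltn_ord (x l)).
  have zi : mono_comp (codegen n.+1 i) x = mono_comp (coface n j.-1) z.
    apply: mono_ext => l; apply: val_inj; rewrite !ffunE /= /bump /unbump.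
    have a (p q r N : nat) : p < q -> r <> p -> r <> q -> q < N.+3 -> r < N.+3 ->
      let s := minn (minn (r - (q < r)) N.+1 - (p < minn (r - (q < r)) N.+1)) N in
      minn (r - (p < r)) N.+1 = (q.-1 <= s) + s by move=> ? ? ? ? ? s; rewrite {}/s; lia.
    exact: a ij (ord_neq (xi l)) (ord_neq (xj l)) (ltn_ord j) (ltn_ord (x l)).
  by rewrite zj zi !act_comp -!/(face _ _) ycomp.
have agree' m (x : mono m n.+2) (i j : 'I_n.+3) : i != k -> j != k ->
    (forall l, x l != i) -> (forall l, x l != j) ->
    act (mono_comp (codegen n.+1 j) x) (y j) = act (mono_comp (codegen n.+1 i) x) (y i).
  move=> ik jk xi xj; case: (ltngtP i j) => [ij|ji|/val_inj -> //].
    exact: agree.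
  by apply/esym/agree.
pose h m (x : horn k m) : X m :=
  let j := sval (cid (svalP x)) in act (mono_comp (codegen n.+1 j) (sval x)) (y j).
have hE m (x : horn k m) (j : 'I_n.+3) : j != k -> (forall i, (sval x : mono m n.+2) i != j) ->
    h m x = act (mono_comp (codegen n.+1 j) (sval x)) (y j).
  by move=> jk xj; rewrite /h; case: cid => i [ik xi]; exact: agree'.
have hact m p (f : mono m p) (x : horn k p) : h m (act f x) = act f (h p x).
  case: (svalP x) => j [jk xj].
  rewrite (hE _ x j) // (hE _ _ j) //=; last by move=> i; rewrite ffunE.
  by rewrite mono_compA act_comp.
have [s sh] := qX _ k kn (SMap hact).
exists (s _ (mono_id n.+2)) => j jk.
have hj : in_horn k (coface n.+1 j : Delta n.+2 n.+1).
  exists j; split=> // i; rewrite ffunE -(inj_eq val_inj) /=.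
  by rewrite eq_sym neq_bump.
rewrite /face -smap_act.
have -> : act (coface n.+1 j) (mono_id n.+2 : Delta _ _) = horn_incl k n.+1 (exist _ _ hj).
  by apply: mono_ext => i; rewrite !ffunE.
rewrite sh /= (hE _ _ j) //; last first.
  by move=> i; rewrite ffunE -(inj_eq val_inj) /= eq_sym neq_bump.
rewrite -[RHS]act_id; congr act; apply: mono_ext => i; apply: val_inj.
by rewrite !ffunE /= bumpK; move: (ltn_ord i); lia.
Qed.

(** * Composition of edges in a quasi-category *)

Lemma face_face (X : sset) n (i j : nat) (w : X n.+2) : i < j ->
  face i (face j w) = face j.-1 (face i w).
Proof.
move=> ij; rewrite /face -!act_comp; congr act.
apply: mono_ext => l; apply: val_inj; rewrite !ffunE /= /bump.
by case: (val l) => [|k]; lia.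
Qed.

Lemma face_degen (X : sset) n i (x : X 0) : face i (degen n.+1 x) = degen n x.
Proof. exact: act_degen. Qed.

Definition codeg0 : mono 2 1 := codegen 1 0.
Definition codeg1 : mono 2 1 := codegen 1 1.

Ltac mono_small :=
  apply: mono_ext => -[[|[|[|?]]] ?] //; apply: val_inj; rewrite !ffunE.

Section Composites.
Variable X : sset.
Implicit Types (a b c : X 1) (x y z : X 0).

Lemma face_codeg0 a :
  [/\ face 2 (act codeg0 a) = degen 1 (face 1 a), face 0 (act codeg0 a) = a
    & face 1 (act codeg0 a) = a].
Proof.
split; rewrite /face /degen -!act_comp; first by congr act; mono_small.
  by rewrite -[RHS]act_id; congr act; mono_small.
by rewrite -[RHS]act_id; congr act; mono_small.
Qed.

Lemma face_codeg1 a :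
  [/\ face 2 (act codeg1 a) = a, face 0 (act codeg1 a) = degen 1 (face 0 a)
    & face 1 (act codeg1 a) = a].
Proof.
split; rewrite /face /degen -!act_comp; last by rewrite -[RHS]act_id; congr act; mono_small.
  by rewrite -[RHS]act_id; congr act; mono_small.
by congr act; mono_small.
Qed.

Lemma composite_idl a x : face 1 a = x -> composite (degen 1 x) a a.
Proof. by move<-; exists (act codeg0 a); case: (face_codeg0 a). Qed.

Lemma composite_idr a y : face 0 a = y -> composite a (degen 1 y) a.
Proof. by move<-; exists (act codeg1 a); case: (face_codeg1 a). Qed.

Lemma composite_ends a b c : composite a b c ->
  [/\ face 0 a = face 1 b, face 1 c = face 1 a & face 0 c = face 0 b].
Proof. by case=> s [<- <- <-]; split; by [rewrite face_face | rewrite [RHS]face_face]. Qed.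

Hypothesis qX : quasicategory X.

Lemma composite_exists a b : face 0 a = face 1 b -> exists c, composite a b c.
Proof.
move=> ab.
have [] := @inner_filler X 0 (Ordinal (isT : 1 < 3)) (fun j => if j == ord0 then b else a) qX isT.
  by case=> [[|[|[|?]]] ?] // [[|[|[|?]]] ?].
move=> w wE; exists (face 1 w), w; split=> //.
  by rewrite (wE (Ordinal (isT : 2 < 3))).
by rewrite (wE (Ordinal (isT : 0 < 3))).
Qed.

(** A 3-simplex with edges [a], [b], [c] along its spine has the four triples below as faces;
    this and the next lemma fill the horns at its vertices 1 and 2. All further properties
    of composition are formal consequences of these two lemmas and the units. *)
Lemma composite_assocl a b c ab bc abc :
  composite a b ab -> composite b c bc -> composite a bc abc -> composite ab c abc.
Proof.
case=> s3 [s32 s30 s31] [s0 [s02 s00 s01]] [s2 [s22 s20 s21]].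
(* The entry at the missing face, here index 1, is arbitrary. *)
have [] := @inner_filler X 1 (Ordinal (isT : 1 < 4)) (fun j => nth s0 [:: s0; s0; s2; s3] j) qX isT.
  by case=> [[|[|[|[|?]]]] ?] // [[|[|[|[|?]]]] ?] //= _ _ _; congruence.
move=> w wE.
have w0 := wE (Ordinal (isT : 0 < 4)) isT.
have w2 := wE (Ordinal (isT : 2 < 4)) isT.
have w3 := wE (Ordinal (isT : 3 < 4)) isT.
exists (face 1 w); split.
- by rewrite -[LHS](@face_face X 1 1 3) //= w3.
- by rewrite face_face //= w0.
- by rewrite -[LHS](@face_face X 1 1 2) //= w2.
Qed.

Lemma composite_assocr a b c ab bc abc :
  composite a b ab -> composite b c bc -> composite ab c abc -> composite a bc abc.
Proof.
case=> s3 [s32 s30 s31] [s0 [s02 s00 s01]] [s1 [s12 s10 s11]].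
have [] := @inner_filler X 1 (Ordinal (isT : 2 < 4)) (fun j => nth s0 [:: s0; s1; s0; s3] j) qX isT.
  by case=> [[|[|[|[|?]]]] ?] // [[|[|[|[|?]]]] ?] //= _ _ _; congruence.
move=> w wE.
have w0 := wE (Ordinal (isT : 0 < 4)) isT.
have w1 := wE (Ordinal (isT : 1 < 4)) isT.
have w3 := wE (Ordinal (isT : 3 < 4)) isT.
exists (face 2 w); split.
- by rewrite -[LHS](@face_face X 1 2 3) //= w3.
- by rewrite face_face //= w0.
- by rewrite face_face //= w1.
Qed.

(** Homotopy of edges as a relation on 1-simplices, without the typing of their ends that
    [homotopic] carries. *)
Definition htpc a b := composite a (degen 1 (face 0 a)) b.

Lemma htpc_composite a b y : face 0 a = y -> composite a (degen 1 y) b -> htpc a b.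
Proof. by move<-. Qed.

Lemma htpc_ends a b : htpc a b -> face 1 a = face 1 b /\ face 0 a = face 0 b.
Proof. by case/composite_ends => _ -> ->; rewrite face_degen degen0. Qed.

Lemma htpc_refl a : htpc a a. Proof. exact: composite_idr. Qed.

Lemma htpc_sym a b : htpc a b -> htpc b a.
Proof.
move=> ab; have [_ e] := htpc_ends ab; rewrite /htpc -e.
apply: composite_assocl ab _ (htpc_refl a).
by apply: composite_idr; rewrite face_degen degen0.
Qed.

Lemma composite_htpc a b c c' : composite a b c -> htpc c c' -> composite a b c'.
Proof.
move=> abc cc'; have [_ _ e] := composite_ends abc.
apply: (composite_assocr abc _ cc'); rewrite e; exact: htpc_refl.
Qed.

Lemma composite_uniq a b c c' : composite a b c -> composite a b c' -> htpc c c'.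
Proof.
move=> abc abc'; have [_ _ e] := composite_ends abc; rewrite /htpc e.
exact: composite_assocl abc (htpc_refl b) abc'.
Qed.

Lemma htpc_trans a b c : htpc a b -> htpc b c -> htpc a c.
Proof. exact: composite_htpc. Qed.

Lemma htpcl a b x : face 1 a = x -> composite (degen 1 x) a b -> htpc a b.
Proof. by move=> ax; apply: composite_uniq; exact: composite_idl. Qed.

Lemma composite_htpcl a a' b c : htpc a a' -> composite a b c -> composite a' b c.
Proof.
move=> aa' abc; have [e _ _] := composite_ends abc.
by apply: (composite_assocl aa' _ abc); rewrite e; exact: composite_idl.
Qed.

Lemma composite_htpcr a b b' c : htpc b b' -> composite a b c -> composite a b' c.
Proof.
move=> bb' abc; have [e _ _] := composite_ends abc.
apply: (composite_assocr (composite_idr e) _ abc).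
by apply: composite_htpc bb'; exact: composite_idl.
Qed.

(** In a category, an arrow whose right inverse has a right inverse is invertible. *)
Lemma right_inverses a b c x y : face 1 a = x -> face 1 b = y ->
  composite a b (degen 1 x) -> composite b c (degen 1 y) -> composite b a (degen 1 y).
Proof.
move=> ax by_ ab bc; have [e1 e2 e3] := composite_ends ab; have [f1 f2 f3] := composite_ends bc.
have cx : face 1 c = x by rewrite -f1 -e3 face_degen degen0.
have ay : face 0 a = y by rewrite e1.
have ac : htpc a c.
  by rewrite /htpc ay; apply: (composite_assocr ab bc); exact: composite_idl.
exact: composite_htpcr (htpc_sym ac) bc.
Qed.

End Composites.

(** * Whiskering and interchange *)

Section Whiskering.
Variable K : cosmos.
Implicit Types A B C D X : K.

Lemma kcomp_degen A B C n (g : functor B C) (f : functor A B) :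
  kcomp (degen n g) (degen n f) = degen n (kcomp g f).
Proof. by rewrite /degen comp_act. Qed.

Lemma whr0 A B C (g : functor B C) (f : functor A B) : whr g f = kcomp g f.
Proof. by rewrite /whr degen0. Qed.

Lemma whr_kcomp A B C D n (b : Map C D n) (g : functor B C) (f : functor A B) :
  whr b (kcomp g f) = whr (whr b g) f.
Proof. by rewrite /whr -kcomp_degen compA. Qed.

Lemma whl_whr A B C D n (g : functor C D) (b : Map B C n) (f : functor A B) :
  whl g (whr b f) = whr (whl g b) f.
Proof. exact: compA. Qed.

Lemma kcomp_idl A B (f : functor A B) : kcomp (idf B) f = f.
Proof. by rewrite -[RHS](comp_idl f) degen0. Qed.

Lemma kcomp_idr A B (f : functor A B) : kcomp f (idf A) = f.
Proof. by rewrite -[RHS](comp_idr f) degen0. Qed.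

Lemma composite_whl A B C (f : functor B C) (a b c : Map A B 1) :
  composite a b c -> composite (whl f a) (whl f b) (whl f c).
Proof. by case=> s [<- <- <-]; exists (whl f s); rewrite /face !whl_act. Qed.

Lemma composite_whr A B C (f : functor A B) (a b c : Map B C 1) :
  composite a b c -> composite (whr a f) (whr b f) (whr c f).
Proof. by case=> s [<- <- <-]; exists (whr s f); rewrite /face !whr_act. Qed.

Lemma htpc_whr A B C (f : functor A B) (a b : Map B C 1) :
  htpc a b -> htpc (whr a f) (whr b f).
Proof.
move=> /(composite_whr f); rewrite /htpc.
by rewrite {2}/whr kcomp_degen /face -whr_act whr0.
Qed.

(** The simplex [kcomp b a] is the diagonal of a square whose two triangles are composites of
    degeneracies: this is the interchange law. *)
Lemma composite_whl_whr A B C (b : Map B C 1) (a : Map A B 1) :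
  composite (whl (face 1 b) a) (whr b (face 0 a)) (kcomp b a).
Proof.
have [b2 b0 b1] := face_codeg0 b; have [a2 a0 a1] := face_codeg1 a.
exists (kcomp (act codeg0 b) (act codeg1 a)).
by rewrite /face !comp_act -!/(face _ _) b0 b1 b2 a0 a1 a2.
Qed.

Lemma composite_whr_whl A B C (b : Map B C 1) (a : Map A B 1) :
  composite (whr b (face 1 a)) (whl (face 0 b) a) (kcomp b a).
Proof.
have [a2 a0 a1] := face_codeg0 a; have [b2 b0 b1] := face_codeg1 b.
exists (kcomp (act codeg1 b) (act codeg0 a)).
by rewrite /face !comp_act -!/(face _ _) b0 b1 b2 a0 a1 a2.
Qed.

Lemma face_whl A B C i (f : functor B C) (a : Map A B 1) :
  face i (whl f a) = kcomp f (face i a).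
Proof. by rewrite /face -whl_act whl0. Qed.

Lemma face_whr A B C i (b : Map B C 1) (f : functor A B) :
  face i (whr b f) = kcomp (face i b) f.
Proof. by rewrite /face -whr_act whr0. Qed.

(** * The universal property of comma objects *)

Definition pairn X A B n (a : Map X A n) (b : Map X B n) : Map X (cprod A B) n :=
  pb_lift (p := term_map (one K) A 0) (cprodP A B)
    (term_uniq (whl (term_map (one K) A 0) a) (whl (term_map (one K) B 0) b)).

Lemma pr1_pairn X A B n (a : Map X A n) (b : Map X B n) : whl (pr1 A B) (pairn a b) = a.
Proof. exact: pb_liftl. Qed.

Lemma pr2_pairn X A B n (a : Map X A n) (b : Map X B n) : whl (pr2 A B) (pairn a b) = b.
Proof. exact: pb_liftr. Qed.

Lemma pr1_cpair X A B (a : functor X A) (b : functor X B) : kcomp (pr1 A B) (cpair a b) = a.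
Proof. by rewrite -whl0; exact: pr1_pairn. Qed.

Lemma pr2_cpair X A B (a : functor X A) (b : functor X B) : kcomp (pr2 A B) (cpair a b) = b.
Proof. by rewrite -whl0; exact: pr2_pairn. Qed.

Lemma cprod_ext X A B n (z z' : Map X (cprod A B) n) :
  whl (pr1 A B) z = whl (pr1 A B) z' -> whl (pr2 A B) z = whl (pr2 A B) z' -> z = z'.
Proof. exact: pb_uniq. Qed.

Definition leg1 A B (E : two_sided A B) : functor (ts_ob E) A := kcomp (pr1 A B) (ts_leg E).
Definition leg0 A B (E : two_sided A B) : functor (ts_ob E) B := kcomp (pr2 A B) (ts_leg E).

(** The strict universal property of [f | g], for a two-sided object [P] with generic edge [k]:
    an [n]-simplex of [map(X, P)] is a map [Delta 1 * Delta n -> map(X, A)] whose ends are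
    the images of simplices of [map(X, B)] and [map(X, C)]. Stating it for any [P] lets the
    commas and the arrow object, which is a cotensor rather than a pullback, be treated
    together. *)
Record comma_object A B C (f : functor B A) (g : functor C A)
    (P : two_sided C B) (k : Map (ts_ob P) A 1) : Prop := CommaObject {
  comma_src : face 1 k = kcomp f (leg0 P);
  comma_tgt : face 0 k = kcomp g (leg1 P);
  comma_lift : forall X n (w : smap (sprod (Delta 1) (Delta n)) (Map X A))
    (c : Map X C n) (b : Map X B n),
    w n (mono_cst n ord0, mono_id n) = whl f b ->
    w n (mono_cst n ord_max, mono_id n) = whl g c ->
    exists z : Map X (ts_ob P) n, [/\ whl (leg1 P) z = c, whl (leg0 P) z = b &
      forall m (u : mono m 1) (t : mono m n), kcomp (act u k) (act t z) = w m (u, t)];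
  comma_uniq : forall X n (z z' : Map X (ts_ob P) n),
    whl (leg1 P) z = whl (leg1 P) z' -> whl (leg0 P) z = whl (leg0 P) z' ->
    (forall m (u : mono m 1) (t : mono m n),
       kcomp (act u k) (act t z) = kcomp (act u k) (act t z')) -> z = z' }.

#[global] Arguments comma_object {A B C} f g P k.

Lemma arrow_ev A m (u : mono m 1) : cot_ev (arrowP A) m u = act u (arrow_cell A).
Proof.
by rewrite -smap_act; congr (cot_ev _ _ _); apply: mono_ext => i; rewrite !ffunE.
Qed.

Lemma arrow_leg1 A : leg1 (ts_arrow A) = arrow_p1 A.
Proof. exact: pr1_cpair. Qed.

Lemma arrow_leg0 A : leg0 (ts_arrow A) = arrow_p0 A.
Proof. exact: pr2_cpair. Qed.

Lemma degen_arrow_p1 A n : degen n (arrow_p1 A) = act (mono_cst n ord_max) (arrow_cell A).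
Proof.
rewrite /degen -smap_act -arrow_ev; congr (cot_ev _ _ _).
by apply: mono_ext => i; rewrite !ffunE.
Qed.

Lemma degen_arrow_p0 A n : degen n (arrow_p0 A) = act (mono_cst n ord0) (arrow_cell A).
Proof.
rewrite /degen -smap_act -arrow_ev; congr (cot_ev _ _ _).
by apply: mono_ext => i; rewrite !ffunE.
Qed.

Lemma arrow_comma A : comma_object (idf A) (idf A) (ts_arrow A) (arrow_cell A).
Proof.
split.
- rewrite arrow_leg0 kcomp_idl -[RHS]degen0 degen_arrow_p0; by congr act; mono_small.
- rewrite arrow_leg1 kcomp_idl -[RHS]degen0 degen_arrow_p1; by congr act; mono_small.
- move=> X n w c b wb wc; exists (cot_lift (arrowP A) w).
  split; last by move=> m u t; rewrite -arrow_ev cot_liftE.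
  + rewrite -[RHS](comp_idl c) -/(whl _ _) -wc -(cot_liftE (arrowP A)) act_id arrow_ev.
    by rewrite arrow_leg1 /whl degen_arrow_p1.
  + rewrite -[RHS](comp_idl b) -/(whl _ _) -wb -(cot_liftE (arrowP A)) act_id arrow_ev.
    by rewrite arrow_leg0 /whl degen_arrow_p0.
- by move=> X n z z' _ _ zz'; apply: cot_uniq => m u t; rewrite arrow_ev.
Qed.

Lemma comma_comma A B C (f : functor B A) (g : functor C A) :
  comma_object f g (ts_comma f g) (comma_cell f g).
Proof.
have cA := arrow_comma A.
have comm1 : kcomp (arrow_p1 A) (pb_fst (commaP f g)) = kcomp g (leg1 (ts_comma f g)).
  rewrite -arrow_leg1 /leg1 -compA pb_comm compA /cprod_map pr1_cpair.
  by rewrite [RHS]compA.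
have comm0 : kcomp (arrow_p0 A) (pb_fst (commaP f g)) = kcomp f (leg0 (ts_comma f g)).
  rewrite -arrow_leg0 /leg0 -compA pb_comm compA /cprod_map pr2_cpair.
  by rewrite [RHS]compA.
have cellE m (u : mono m 1) X n (t : mono m n) (z : Map X (comma f g) n) :
    kcomp (act u (comma_cell f g)) (act t z) =
    kcomp (act u (arrow_cell A)) (act t (whl (pb_fst (commaP f g)) z)).
  by rewrite /comma_cell -whr_act -whl_act /whr /whl compA.
split.
- by rewrite /comma_cell /face -whr_act whr0 -/(face _ _) (comma_src cA) arrow_leg0 kcomp_idl.
- by rewrite /comma_cell /face -whr_act whr0 -/(face _ _) (comma_tgt cA) arrow_leg1 kcomp_idl.
- move=> X n w c b wb wc.
  have [a [ac ab aw]] := comma_lift cA (X := X) (n := n) (w := w) (c := whl g c) (b := whl f b)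
     (etrans wb (esym (comp_idl _))) (etrans wc (esym (comp_idl _))).
  have h : whl (arrow_leg A) a = whl (cprod_map g f) (pairn c b).
    apply: cprod_ext; rewrite -!whl_kcomp.
      by rewrite -/(leg1 (ts_arrow A)) ac pr1_cpair whl_kcomp pr1_pairn.
    by rewrite -/(leg0 (ts_arrow A)) ab pr2_cpair whl_kcomp pr2_pairn.
  exists (pb_lift (commaP f g) h); split.
  + by rewrite whl_kcomp pb_liftr pr1_pairn.
  + by rewrite whl_kcomp pb_liftr pr2_pairn.
  + by move=> m u t; rewrite cellE pb_liftl.
- move=> X n z z' z1 z0 zz'; apply: (pb_uniq (p := arrow_leg A)).
    apply: (comma_uniq cA) => [||m u t].
    + by rewrite -!whl_kcomp arrow_leg1 comm1 !(whl_kcomp g) z1.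
    + by rewrite -!whl_kcomp arrow_leg0 comm0 !(whl_kcomp f) z0.
    + by rewrite -!cellE.
  by apply: cprod_ext; rewrite -!whl_kcomp.
Qed.

End Whiskering.

(** * Cells into a comma object *)

Lemma sval_inj (T : Type) (Q : T -> Prop) : injective (@sval T Q).
Proof. by move=> [a pa] [a' pa'] /= aa'; apply: eq_exist. Qed.

(** Maps out of [Delta 1 * Delta n] obtained from a simplex along a map of posets [r]. *)
Section Prism.
Variables (n k : nat) (r : 'I_2 -> 'I_n.+1 -> 'I_k.+1).
Hypothesis r_homo : forall (s s' : 'I_2) (t t' : 'I_n.+1),
  s <= s' -> t <= t' -> r s t <= r s' t'.

Definition prism_mono m (u : mono m 1) (t : mono m n) : mono m k :=
  mono_of (fun i j ij => r_homo (mono_homo u ij) (mono_homo t ij)).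

Definition prism (X : sset) (x : X k) : smap (sprod (Delta 1) (Delta n)) X.
Proof.
refine (@SMap (sprod (Delta 1) (Delta n)) X (fun m z => act (prism_mono z.1 z.2) x) _).
by move=> m p h z; rewrite -act_comp; congr act; apply: mono_ext => i; rewrite !ffunE.
Defined.

End Prism.

(** The map [Delta 1 * Delta n -> Delta n.+1] collapsing the end 0 of the prism to the initial
    vertex and sending the end 1 to the opposite face. *)
Definition cone_fun n (s : 'I_2) (t : 'I_n.+1) : 'I_n.+2 :=
  if s == ord0 then ord0 else lift ord0 t.

Lemma cone_homo n (s s' : 'I_2) (t t' : 'I_n.+1) :
  s <= s' -> t <= t' -> cone_fun s t <= cone_fun s' t'.
Proof.
rewrite /cone_fun -!(inj_eq val_inj) => ss tt.
by case: s s' ss => [[|?] ?] [[|?] ?].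
Qed.

Definition cone_mono n m : mono m 1 -> mono m n -> mono m n.+1 :=
  prism_mono (@cone_homo n) (m := m).

Definition vertex0 (X : sset) n (x : X n) : X 0 := act (mono_cst 0 ord0) x.

Lemma vertex0_face (X : sset) n i (x : X n.+1) : vertex0 (face i.+1 x) = vertex0 x.
Proof. by rewrite /vertex0 /face -act_comp; congr act; mono_small. Qed.

Lemma vertex0_edge (X : sset) (x : X 1) : vertex0 x = face 1 x.
Proof. by congr act; mono_small. Qed.

Section Cones.
Variables (K : cosmos) (A B C X : K) (f : functor B A) (g : functor C A).
Variables (P : two_sided C B) (k : Map (ts_ob P) A 1).
Hypothesis cP : comma_object f g P k.
Variables (c : functor X C) (b : functor X B).

(** The [n]-simplex [z] of [map(X, P)], with constant legs, corresponds to the prism obtained by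
    collapsing onto the [n.+1]-simplex [s]. This embeds the mapping space made of simplices
    with degenerate face 0 into the fibre of [map(X, P)]; inverses of edges are easier to
    find in the former. *)
Definition cone_lifts n (s : Map X A n.+1) (z : Map X (ts_ob P) n) : Prop :=
  [/\ whl (leg1 P) z = degen n c, whl (leg0 P) z = degen n b &
      forall m (u : mono m 1) (t : mono m n), kcomp (act u k) (act t z) = act (cone_mono u t) s].

Lemma cone_lifts_uniq n (s : Map X A n.+1) z z' :
  cone_lifts s z -> cone_lifts s z' -> z = z'.
Proof.
move=> [z1 z0 zs] [z1' z0' zs'].
apply: (comma_uniq cP) => [||m u t]; [by rewrite z1|by rewrite z0|by rewrite zs].
Qed.

Lemma cone_lifts_act m n (h : mono m n) (h' : mono m.+1 n.+1) s z :
  h' ord0 = ord0 -> (forall i, h' (lift ord0 i) = lift ord0 (h i)) ->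
  cone_lifts s z -> cone_lifts (act h' s) (act h z).
Proof.
move=> h0 hS [z1 z0 zs]; split; rewrite ?whl_act ?z1 ?z0 ?act_degen // => p u t.
rewrite -!act_comp zs; congr act; apply: mono_ext => i; rewrite !ffunE /cone_fun.
by case: ifP => _; rewrite ?h0 ?hS.
Qed.

Lemma cone_lifts_face n i (s : Map X A n.+2) z :
  cone_lifts s z -> cone_lifts (face i.+1 s) (face i z).
Proof.
apply: cone_lifts_act => [|j]; apply: val_inj; rewrite !ffunE //=.
by rewrite /bump; lia.
Qed.

Lemma cone_lifts_degen (s : Map X A 1) z :
  cone_lifts s z -> cone_lifts (act codeg1 s) (degen 1 z).
Proof.
by apply: cone_lifts_act => [|[[|[|?]] ?]] //; apply: val_inj; rewrite !ffunE.
Qed.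

Lemma cone_lifts_whr (e : functor X (ts_ob P)) :
  kcomp (leg1 P) e = c -> kcomp (leg0 P) e = b -> cone_lifts (whr k e) e.
Proof.
move=> e1 e0; split; rewrite ?whl0 ?degen0 // => m u t.
rewrite -whr_act /whr /degen; congr (kcomp _ _).
  congr act; apply: mono_ext => i; rewrite !ffunE /cone_fun.
  by case: (u i) => [[|[|?]] ?]; apply: val_inj; rewrite //= ord1.
by congr act; apply: mono_ext => i; rewrite !ffunE ord1.
Qed.

Lemma cone_lifts_exists n (s : Map X A n.+1) :
  vertex0 s = kcomp f b -> face 0 s = degen n (kcomp g c) ->
  exists z, cone_lifts s z.
Proof.
move=> s0 s1.
have [||z [z1 z0 zs]] := comma_lift cP (w := prism (@cone_homo n) s)
  (c := degen n c) (b := degen n b).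
- rewrite /whl kcomp_degen -s0 /= /degen /vertex0 -act_comp; congr act.
  by apply: mono_ext => i; rewrite !ffunE.
- rewrite /whl kcomp_degen -s1 /=; congr act.
  by apply: mono_ext => i; apply: val_inj; rewrite !ffunE.
by exists z; split.
Qed.

Let y := kcomp g c.

(** Filling the horn at the vertex 1 of [Delta 3] with faces [s], a degeneracy of the first edge
    of [s] and a degeneracy of [y]: the new face is a homotopy [s'] backwards, and the whole
    3-simplex says that the fibred edge of [s'] is right inverse to that of [s]. *)
Lemma homotopy_inverse (s : Map X A 2) z :
  vertex0 s = kcomp f b -> face 0 s = degen 1 y -> cone_lifts s z ->
  exists s' z' (q : Map X (ts_ob P) 2),
    [/\ [/\ face 2 s' = face 1 s, face 0 s' = degen 1 y & face 1 s' = face 2 s],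
        cone_lifts s' z',
        [/\ face 2 q = z, face 0 q = z' & face 1 q = degen 1 (face 1 z)]
      & whl (leg1 P) q = degen 2 c /\ whl (leg0 P) q = degen 2 b].
Proof.
move=> s0 sy sz.
have s2y : face 0 (face 2 s) = y by rewrite face_face // sy face_degen degen0.
have [c2 c0 c1] := face_codeg1 (face 2 s).
(* The entry at index 1, the missing face, is arbitrary. *)
have [] := @inner_filler (Map X A) 1 (Ordinal (isT : 1 < 4))
   (fun j => nth (degen 2 y) [:: degen 2 y; degen 2 y; act codeg1 (face 2 s); s] j)
   (@map_qcat K X A) isT.
  case=> [[|[|[|[|?]]]] ?] // [[|[|[|[|?]]]] ?] //= _ _ _.
  - by rewrite c0 s2y face_degen.
  - by rewrite sy face_degen.
move=> t tE.
have t0 := tE (Ordinal (isT : 0 < 4)) isT.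
have t2 := tE (Ordinal (isT : 2 < 4)) isT.
have t3 := tE (Ordinal (isT : 3 < 4)) isT.
rewrite /= in t0 t2 t3.
have [q qt] : exists q, cone_lifts t q.
  by apply: cone_lifts_exists => //; rewrite -(vertex0_face 2 t) t3.
exists (face 1 t), (face 0 q), q; split.
- split.
  + by rewrite -[LHS](@face_face (Map X A) 1 1 3) //= t3.
  + by rewrite face_face //= t0 face_degen.
  + by rewrite -[LHS](@face_face (Map X A) 1 1 2) //= t2.
- exact: cone_lifts_face.
- split=> //.
  + by apply: cone_lifts_uniq sz; rewrite -t3; exact: cone_lifts_face.
  + apply: (@cone_lifts_uniq _ (act codeg1 (face 2 s))).
      by rewrite -t2; exact: cone_lifts_face.
    exact: cone_lifts_degen (cone_lifts_face 1 sz).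
- by case: qt.
Qed.

Let Fib := fibre (postcomp X (ts_leg P)) (cpair c b).

Lemma fibreP n (z : Map X (ts_ob P) n) :
  whl (ts_leg P) z = degen n (cpair c b) <->
  whl (leg1 P) z = degen n c /\ whl (leg0 P) z = degen n b.
Proof.
have d1 : whl (pr1 C B) (degen n (cpair c b)) = degen n c by rewrite /whl kcomp_degen pr1_cpair.
have d0 : whl (pr2 C B) (degen n (cpair c b)) = degen n b by rewrite /whl kcomp_degen pr2_cpair.
split=> [zE|[z1 z0]]; first by rewrite !whl_kcomp zE.
by apply: cprod_ext; rewrite -!whl_kcomp ?d1 ?d0.
Qed.

Lemma fibre_qcat : quasicategory Fib.
Proof.
move=> n j jn h.
have [inner _] := isofib_map X (ts_isofib P).
pose h' : smap (horn j) (Map X (ts_ob P)) :=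
  @SMap (horn j) (Map X (ts_ob P)) (fun m x => sval (h m x))
    (fun m p t x => congr1 sval (smap_act h t x)).
pose v : smap (Delta n) (Map X (cprod C B)) :=
  @SMap (Delta n) (Map X (cprod C B)) (fun m _ => degen m (cpair c b))
    (fun m p t _ => esym (act_degen t _)).
have [|w [wh wv]] := inner n j jn h' v; first by move=> m x; exact: (svalP (h m x)).
exists (@SMap (Delta n) Fib (fun m x => exist _ (w m x) (wv m x))
  (fun m p t x => eq_exist _ _ (smap_act w t x))) => m x.
by apply: sval_inj; rewrite /= wh.
Qed.

Lemma fibre_composite (a a' d : Fib 1) (q : Map X (ts_ob P) 2) :
  whl (leg1 P) q = degen 2 c -> whl (leg0 P) q = degen 2 b ->
  face 2 q = sval a -> face 0 q = sval a' -> face 1 q = sval d -> composite a a' d.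
Proof.
move=> q1 q0 qa qa' qd.
by exists (exist _ q ((fibreP q).2 (conj q1 q0))); split; apply: sval_inj.
Qed.

Lemma fibre_legs (e : Fib 0) : kcomp (leg1 P) (sval e) = c /\ kcomp (leg0 P) (sval e) = b.
Proof. by have [e1 e0] := (fibreP (sval e)).1 (svalP e); rewrite -!whl0 e1 e0 !degen0. Qed.

Lemma fibre_src (e : Fib 0) : face 1 (whr k (sval e)) = kcomp f b.
Proof. by rewrite face_whr (comma_src cP) -compA (fibre_legs e).2. Qed.

Lemma fibre_tgt (e : Fib 0) : face 0 (whr k (sval e)) = y.
Proof. by rewrite face_whr (comma_tgt cP) -compA (fibre_legs e).1. Qed.

(** The homotopy lifts to an edge of the fibre with a right inverse, which again comes from
    a homotopy and so has a right inverse. *)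
Lemma htpc_isomorphic (e e' : Fib 0) :
  htpc (whr k (sval e)) (whr k (sval e')) -> isomorphic e e'.
Proof.
move=> [s [s2 s0 s1]]; rewrite fibre_tgt in s0.
have [[e1 e0] [e1' e0']] := (fibre_legs e, fibre_legs e').
have sb : vertex0 s = kcomp f b by rewrite -(vertex0_face 1) s2 vertex0_edge fibre_src.
have [z sz] := cone_lifts_exists sb s0.
have [s' [z' [q [[s'2 s'0 s'1] sz' [q2 q0 q1] [qc qb]]]]] := homotopy_inverse sb s0 sz.
have s'b : vertex0 s' = kcomp f b by rewrite -(vertex0_face 1) s'2 s1 vertex0_edge fibre_src.
(* Applied to the backwards homotopy, this gives a right inverse of the right inverse. *)
have [s'' [z'' [q' [_ sz'' [q'2 q'0 q'1] [q'c q'b]]]]] := homotopy_inverse s'b s'0 sz'.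
have lift_e : cone_lifts (whr k (sval e)) (sval e) by exact: cone_lifts_whr.
have lift_e' : cone_lifts (whr k (sval e')) (sval e') by exact: cone_lifts_whr.
have z1 : face 1 z = sval e.
  by apply: (cone_lifts_uniq _ lift_e); rewrite -s2; exact: cone_lifts_face.
have z0 : face 0 z = sval e'.
  by apply: (cone_lifts_uniq _ lift_e'); rewrite -s1; exact: cone_lifts_face.
have z'1 : face 1 z' = sval e'.
  by apply: (cone_lifts_uniq _ lift_e'); rewrite -s1 -s'2; exact: cone_lifts_face.
have z'0 : face 0 z' = sval e.
  by apply: (cone_lifts_uniq _ lift_e); rewrite -s2 -s'1; exact: cone_lifts_face.
have fib m (r : Map X A m.+1) (t : Map X (ts_ob P) m) : cone_lifts r t ->
    whl (ts_leg P) t = degen m (cpair c b) by case=> ? ? _; apply/fibreP.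
pose p : Fib 1 := exist _ z (fib _ _ _ sz); pose p' : Fib 1 := exist _ z' (fib _ _ _ sz').
pose p'' : Fib 1 := exist _ z'' (fib _ _ _ sz'').
have pp' : composite p p' (degen 1 e) by apply: (fibre_composite (q := q)); rewrite //= -z1.
have p'p'' : composite p' p'' (degen 1 e') by apply: (fibre_composite (q := q')); rewrite //= -z'1.
have pe : face 1 p = e by exact: sval_inj.
have p'e : face 1 p' = e' by exact: sval_inj.
have pe' : face 0 p = e' by exact: sval_inj.
have p'e' : face 0 p' = e by exact: sval_inj.
exists (exist _ p (conj pe pe')), (exist _ p' (conj p'e p'e')).
have qF : quasicategory Fib by move=> n; exact: fibre_qcat.
by split; [exact: pp' | exact: (right_inverses qF pe p'e pp' p'p'')].
Qed.

(** The edge [p] of the fibre is constant on both legs, so interchanging it with [k] shows both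
    edges homotopic to [kcomp k p]. *)
Lemma isomorphic_htpc (e e' : Fib 0) :
  isomorphic e e' -> htpc (whr k (sval e)) (whr k (sval e')).
Proof.
have qX := @map_qcat K X A.
move=> [[p [pe pe']] _].
have z1 : face 1 (sval p) = sval e by rewrite -pe.
have z0 : face 0 (sval p) = sval e' by rewrite -pe'.
have [lc lb] := (fibreP (sval p)).1 (svalP p).
have := composite_whr_whl k (sval p).
rewrite z1 (comma_tgt cP) whl_kcomp lc /whl kcomp_degen -/y => /(htpc_composite (fibre_tgt e)) h.
have := composite_whl_whr k (sval p).
rewrite z0 (comma_src cP) whl_kcomp lb /whl kcomp_degen => /(htpcl qX (fibre_src e')) h'.
exact: (htpc_trans qX h (htpc_sym qX h')).
Qed.

Lemma isomorphic_closureP (e e' : Fib 0) :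
  clos_refl_sym_trans _ (@isomorphic Fib) e e' <->
  htpc (whr k (sval e)) (whr k (sval e')).
Proof.
have qX := @map_qcat K X A.
split=> [|/htpc_isomorphic]; last exact: rst_step.
elim=> [d d'|d|d d' _|d d' d'' _ h _ h'].
- exact: isomorphic_htpc.
- exact: htpc_refl.
- exact: (htpc_sym qX).
- exact: (htpc_trans qX h h').
Qed.

End Cones.

Lemma homotopic_closureP (X : sset) (x y : X 0) (a a' : edge x y) : quasicategory X ->
  clos_refl_sym_trans _ (@homotopic X x y) a a' <-> htpc (sval a) (sval a').
Proof.
move=> qX; split=> [|h]; last by apply: rst_step; move: h; rewrite /htpc (svalP a).2.
elim=> [d d'|d|d d' _|d d' d'' _ h _ h'].
- by rewrite /homotopic /htpc (svalP d).2.
- exact: htpc_refl.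
- exact: (htpc_sym qX).
- exact: (htpc_trans qX h h').
Qed.

(** * Bijections between quotients *)

Section Quotients.
Variables (T : Type) (R : relation T).

Lemma quot_class (q : quot R) : exists x, sval q x.
Proof. by have [x qx] := svalP q; exists x; rewrite qx; exact: rst_refl. Qed.

Lemma quot_rel (q : quot R) x x' : sval q x -> sval q x' <-> clos_refl_sym_trans T R x x'.
Proof.
have [z ->] := svalP q; move=> zx; split=> [zx'|]; last exact: rst_trans.
exact: rst_trans (rst_sym _ _ _ _ zx) zx'.
Qed.

Lemma quot_eq (q q' : quot R) x : sval q x -> sval q' x -> q = q'.
Proof.
move=> qx q'x; apply: sval_inj; apply/funext => z; apply/propext.
by rewrite (quot_rel _ qx) (quot_rel _ q'x).
Qed.
End Quotients.

(** A relation between representatives that is total on both sides and matches the two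
    equivalences induces a bijection of quotients. The relation, unlike a function, need
    not choose representatives, and it still characterises all members of [F q]. *)
Lemma quot_correspondence (T U : Type) (R : relation T) (S : relation U) (G : T -> U -> Prop) :
  (forall x, exists y, G x y) -> (forall y, exists x, G x y) ->
  (forall x y y', G x y -> clos_refl_sym_trans U S y y' -> G x y') ->
  (forall x x' y y', G x y -> G x' y' ->
     (clos_refl_sym_trans T R x x' <-> clos_refl_sym_trans U S y y')) ->
  exists F : quot R -> quot S, bijective F /\
    forall q x, sval q x -> forall y, sval (F q) y <-> G x y.
Proof.
move=> total surj inv GG.
have /choice[F FE] (q : quot R) : exists q' : quot S,
    forall x, sval q x -> forall y, sval q' y <-> G x y.
  have [x0 qx0] := quot_class q; have [y0 xy0] := total x0.
  pose q' : quot S := exist _ (clos_refl_sym_trans U S y0) (ex_intro _ y0 erefl).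
  exists q' => x qx y; have [y1 xy1] := total x.
  have xx := (quot_rel x qx0).1 qx.
  split=> [|xy]; last exact: (GG _ _ _ _ xy0 xy).1.
  move=> y0y; apply: (inv _ _ _ xy1); have y01 := (GG _ _ _ _ xy0 xy1).1 xx.
  exact: rst_trans (rst_sym _ _ _ _ y01) y0y.
exists F; split=> //.
have Finj : injective F.
  move=> q q' FF; have [[x qx] [x' qx']] := (quot_class q, quot_class q').
  have [y xy] := total x; have := (FE _ _ qx _).2 xy; rewrite FF => /(FE _ _ qx') x'y.
  apply: (quot_eq qx); apply/(quot_rel _ qx').
  by apply: (GG _ _ _ _ x'y xy).2; apply: rst_refl.
have /choice[F' F'E] (q : quot S) : exists q', F q' = q.
  have [y qy] := quot_class q; have [x xy] := surj y.
  exists (exist _ (clos_refl_sym_trans T R x) (ex_intro _ x erefl)).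
  by apply: (quot_eq _ qy); apply/(FE _ x); first exact: rst_refl.
by exists F' => // q; apply: Finj.
Qed.

(** * Transposition along the projections of a comma object *)

Section Representability.
Variable K : cosmos.

(** The relation [H] induces a bijection between homotopy classes of edges [f -> g] and of
    edges [x -> y]. *)
Record transposition (A B X Y : K) (f g : functor A B) (x y : functor X Y)
    (H : Map A B 1 -> Map X Y 1 -> Prop) : Prop := Transposition {
  transpose : forall a, face 1 a = f -> face 0 a = g ->
    exists b, [/\ face 1 b = x, face 0 b = y & H a b];
  untranspose : forall b, face 1 b = x -> face 0 b = y ->
    exists a, [/\ face 1 a = f, face 0 a = g & H a b];
  transposition_htpc : forall a b b', H a b -> htpc b b' -> H a b';
  transposition_inj : forall a a' b b', face 1 a = f -> face 0 a = g ->
    face 1 a' = f -> face 0 a' = g -> H a b -> H a' b' -> htpc a a' <-> htpc b b' }.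

Definition over (A B C D : K) (u : functor A C) (v : functor B D)
    (E : two_sided A B) (P : two_sided C D) (e : functor (ts_ob E) (ts_ob P)) : Prop :=
  kcomp (leg1 P) e = kcomp u (leg1 E) /\ kcomp (leg0 P) e = kcomp v (leg0 E).

#[global] Arguments over {A B C D} u v E P e.

(** The cells of [E] into [P] are the classes of edges between the two functors composed from the
    legs of [E] and the defining cospan of [P], so any correspondence of edges [f -> g]
    with these edges is one with cells. *)
Lemma cells_of_2cells (A B A' B' C D Y : K) (f g : functor A B)
    (u : functor A' C) (v : functor B' D) (E : two_sided A' B') (P : two_sided C D)
    (s : functor D Y) (t : functor C Y) (k : Map (ts_ob P) Y 1)
    (H : Map A B 1 -> Map (ts_ob E) Y 1 -> Prop) :
  comma_object s t P k ->
  transposition f g (kcomp s (kcomp v (leg0 E))) (kcomp t (kcomp u (leg1 E))) H ->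
  exists F : cell2 f g -> cell u v E P, bijective F /\
    forall q a, cell2_rep q a -> forall e, cell_rep (F q) e <-> over u v E P e /\ H a (whr k e).
Proof.
move=> cP tH.
set c := kcomp u (leg1 E); set b := kcomp v (leg0 E).
pose G (a : edge f g) (e : cell_fibre u v E P 0) := H (sval a) (whr k (sval e)).
have [a|e|a e e' Ge ee'|a a' e e' Ge Ge'|F [Fbij FE]] :=
  @quot_correspondence _ _ (@homotopic (Map A B) f g) (@isomorphic (cell_fibre u v E P)) G.
- have [r [r1 r0 ar]] := transpose tH (svalP a).1 (svalP a).2.
  have [||z] := cone_lifts_exists cP (s := r) (c := c) (b := b); rewrite ?vertex0_edge ?degen0 //.
  case=> z1 z0 zr.
  exists (exist _ z ((fibreP c b z).2 (conj z1 z0))).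
  rewrite /G /=; suff -> : whr k z = r by [].
  have := zr _ (mono_id 1) (mono_cst 1 ord0); rewrite act_id -/(degen 1 z) -/(whr k z) => ->.
  rewrite -[RHS]act_id; congr act; apply: mono_ext => i; rewrite !ffunE /cone_fun.
  by case: i => [[|[|?]] ?]; apply: val_inj; rewrite //= ffunE.
- have [a [a1 a0 ae]] := untranspose tH (fibre_src cP e) (fibre_tgt cP e).
  by exists (exist _ a (conj a1 a0)).
- exact: (transposition_htpc tH) Ge ((isomorphic_closureP cP _ _).1 ee').
- rewrite (homotopic_closureP _ _ (@map_qcat K A B)) (isomorphic_closureP cP).
  by apply: (transposition_inj tH) => //; case: (svalP a) (svalP a') => ? ? [].
exists F; split=> // q a [ar qa] e; have Fq := FE _ _ qa; split.
  move=> [ez Fe]; split; last exact: (Fq _).1 Fe.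
  by have := fibre_legs (exist _ e ez).
move=> [[e1 e0] ae].
have ez : whl (ts_leg P) e = degen 0 (cpair c b) by apply/fibreP; rewrite !whl0 !degen0.
by exists ez; apply/Fq.
Qed.

Section Reflection.
Variables (A B X Y : K) (p : functor X A) (i : functor A X) (h : Map X X 1).
Hypotheses (pi : kcomp p i = idf A) (hp : whl p h = degen 1 p).

(** Here [p] is left adjoint to [i] with unit [h] and identity counit. Restriction along [i]
    inverts pasting with [k = s h]: interchange of [b : s => g p] with [h] gives
    [b = (b i p) k], since [g p h] is an identity. *)
Lemma reflection_transposition (s : functor X B) (f g : functor A B) (k : Map X B 1) :
  face 1 h = idf X -> face 0 h = kcomp i p ->
  kcomp s i = f -> whl s h = k -> whr k i = degen 1 f ->
  transposition f g s (kcomp g p) (fun a b => composite k (whr a p) b).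
Proof.
move=> h1 h0 si sk ki.
have qA := @map_qcat K A B; have qX := @map_qcat K X B.
have whr_pi n (a : Map A B n) : whr (whr a p) i = a.
  by rewrite -whr_kcomp pi /whr comp_idr.
have k1 : face 1 k = s by rewrite -sk face_whl h1 kcomp_idr.
have k0 : face 0 k = kcomp f p by rewrite -sk face_whl h0 compA si.
have restrict a b : composite k (whr a p) b -> face 1 a = f -> htpc a (whr b i).
  by move=> /(composite_whr i); rewrite ki whr_pi => ab a1; apply: htpcl ab.
split.
- move=> a a1 a0; have [|b ab] := composite_exists qX (a := k) (b := whr a p).
    by rewrite k0 face_whr a1.
  by exists b; have [_ b1 b0] := composite_ends ab; rewrite b1 b0 k1 face_whr a0.
- move=> b b1 b0; exists (whr b i); rewrite !face_whr b1 b0 -compA pi kcomp_idr; split=> //.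
  (* One side of the interchange square of [b] and [h] is an identity, so [b] is
     homotopic to its diagonal. *)
  have := composite_whr_whl b h; rewrite h1 b0 whl_kcomp hp /whl /whr comp_idr kcomp_degen.
  move=> /(htpc_composite b0) hb.
  have := composite_whl_whr b h; rewrite b1 h0 sk whr_kcomp => c.
  exact: (composite_htpc qX c (htpc_sym qX hb)).
- by move=> a b b' ab; exact: composite_htpc.
- move=> a a' b b' a1 a0 a1' a0' ab ab'; split=> [aa'|bb'].
    exact: (composite_uniq qX (composite_htpcr qX (htpc_whr p aa') ab) ab').
  apply: (htpc_trans qA (restrict _ _ ab a1)).
  exact: (htpc_trans qA (htpc_whr i bb') (htpc_sym qA (restrict _ _ ab' a1'))).
Qed.

(** The dual, where [p] is right adjoint to [i] with counit [h] and identity unit. *)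
Lemma coreflection_transposition (s : functor X B) (f g : functor A B) (k : Map X B 1) :
  face 1 h = kcomp i p -> face 0 h = idf X ->
  kcomp s i = g -> whl s h = k -> whr k i = degen 1 g ->
  transposition f g (kcomp f p) s (fun a b => composite (whr a p) k b).
Proof.
move=> h1 h0 si sk ki.
have qA := @map_qcat K A B; have qX := @map_qcat K X B.
have whr_pi n (a : Map A B n) : whr (whr a p) i = a.
  by rewrite -whr_kcomp pi /whr comp_idr.
have k0 : face 0 k = s by rewrite -sk face_whl h0 kcomp_idr.
have k1 : face 1 k = kcomp g p by rewrite -sk face_whl h1 compA si.
have restrict a b : composite (whr a p) k b -> face 0 a = g -> htpc a (whr b i).
  by move=> /(composite_whr i); rewrite ki whr_pi => ab a0; apply: htpc_composite ab.
split.
- move=> a a1 a0; have [|b ab] := composite_exists qX (a := whr a p) (b := k).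
    by rewrite k1 face_whr a0.
  by exists b; have [_ b1 b0] := composite_ends ab; rewrite b1 b0 k0 face_whr a1.
- move=> b b1 b0; exists (whr b i); rewrite !face_whr b1 b0 -compA pi kcomp_idr; split=> //.
  have := composite_whl_whr b h; rewrite h0 b1 whl_kcomp hp /whl /whr comp_idr kcomp_degen.
  move=> /(htpcl qX b1) hb.
  have := composite_whr_whl b h; rewrite b0 h1 sk whr_kcomp => c.
  exact: (composite_htpc qX c (htpc_sym qX hb)).
- by move=> a b b' ab; exact: composite_htpc.
- move=> a a' b b' a1 a0 a1' a0' ab ab'; split=> [aa'|bb'].
    exact: (composite_uniq qX (composite_htpcl qX (htpc_whr p aa') ab) ab').
  apply: (htpc_trans qA (restrict _ _ ab a0)).
  exact: (htpc_trans qA (htpc_whr i bb') (htpc_sym qA (restrict _ _ ab' a0'))).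
Qed.

End Reflection.

Definition max_fun (s t : 'I_2) : 'I_2 := if s == ord0 then t else ord_max.
Definition min_fun (s t : 'I_2) : 'I_2 := if s == ord0 then ord0 else t.

Lemma max_homo (s s' t t' : 'I_2) : s <= s' -> t <= t' -> max_fun s t <= max_fun s' t'.
Proof. by case: s s' t t' => [[|[|?]] ?] [[|[|?]] ?] [[|[|?]] ?] [[|[|?]] ?]. Qed.

Lemma min_homo (s s' t t' : 'I_2) : s <= s' -> t <= t' -> min_fun s t <= min_fun s' t'.
Proof. by case: s s' t t' => [[|[|?]] ?] [[|[|?]] ?] [[|[|?]] ?] [[|[|?]] ?]. Qed.

Ltac mono_square u t :=
  let j := fresh in apply: mono_ext => j; rewrite !ffunE;
  case: (t j) => [[|?] ?] //; case: (u j) => [[|[|?]] ?] //; apply: val_inj.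

(** The functor into [P] classified by an identity 2-cell. *)
Lemma degenerate_lift (A B C X : K) (f : functor B A) (g : functor C A) (P : two_sided C B)
    (k : Map (ts_ob P) A 1) (c : functor X C) (b : functor X B) :
  comma_object f g P k -> kcomp f b = kcomp g c ->
  exists i, [/\ kcomp (leg1 P) i = c, kcomp (leg0 P) i = b & whr k i = degen 1 (kcomp g c)].
Proof.
move=> cP fg.
have [||i [i1 i0 ik]] := cone_lifts_exists cP (s := degen 1 (kcomp g c)) (c := c) (b := b).
- by rewrite vertex0_edge face_degen degen0.
- by rewrite face_degen.
exists i; split; [by rewrite -whl0 i1 degen0|by rewrite -whl0 i0 degen0|].
have := ik _ (mono_id 1) (mono_cst 1 ord0); rewrite act_id -/(degen 1 i) -/(whr k i) => ->.
exact: act_degen.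
Qed.

(** The right adjoint [i] sends [c] to the identity of [g c]. The component of the unit at an
    arrow [a -> g c] is the square from that arrow to this identity with sides the arrow
    itself and an identity, which is the map [max] on [Delta 1 * Delta 1]. *)
Lemma comma_reflection (A C : K) (g : functor C A) (P : two_sided C A) (k : Map (ts_ob P) A 1) :
  comma_object (idf A) g P k ->
  exists (i : functor C (ts_ob P)) (h : Map (ts_ob P) (ts_ob P) 1),
    [/\ kcomp (leg1 P) i = idf C, kcomp (leg0 P) i = g & whr k i = degen 1 g] /\
    [/\ face 1 h = idf (ts_ob P), face 0 h = kcomp i (leg1 P),
        whl (leg1 P) h = degen 1 (leg1 P) & whl (leg0 P) h = k].
Proof.
move=> cP.
have [|i [i1 i0 ik]] := degenerate_lift (c := idf C) (b := g) cP.
  by rewrite kcomp_idl kcomp_idr.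
rewrite kcomp_idr in ik.
have [||h [h1 h0 hk]] := comma_lift cP (w := prism max_homo k) (c := degen 1 (leg1 P)) (b := k).
- rewrite /whl comp_idl -[RHS]act_id /=; by congr act; mono_small.
- rewrite /whl kcomp_degen -(comma_tgt cP) /= /degen /face -act_comp; by congr act; mono_small.
exists i, h; split=> //; split=> //.
- apply: (comma_uniq cP) => [||m u t].
  + by rewrite /face whl_act h1 act_degen degen0 whl0 kcomp_idr.
  + by rewrite /face whl_act h0 -/(face 1 k) (comma_src cP) whl0 kcomp_idl kcomp_idr.
  + rewrite -act_comp hk -[idf _]degen0 act_degen comp_idr /=; congr act.
    by mono_square u t.
- apply: (comma_uniq cP) => [||m u t].
  + by rewrite /face whl_act h1 act_degen degen0 whl0 compA i1 kcomp_idl.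
  + by rewrite /face whl_act h0 -/(face 0 k) (comma_tgt cP) whl0 compA i0.
  + rewrite -act_comp hk -[kcomp i _]degen0 act_degen -/(whr _ _) whr_act whr_kcomp ik.
    rewrite /whr kcomp_degen act_degen -(comma_tgt cP) /= /degen /face -act_comp; congr act.
    by mono_square u t.
Qed.

(** The counit at an arrow [f b -> a] is the square from the identity of [f b] to that arrow,
    which is the map [min]. *)
Lemma comma_coreflection (A B : K) (f : functor B A) (P : two_sided A B) (k : Map (ts_ob P) A 1) :
  comma_object f (idf A) P k ->
  exists (i : functor B (ts_ob P)) (h : Map (ts_ob P) (ts_ob P) 1),
    [/\ kcomp (leg0 P) i = idf B, kcomp (leg1 P) i = f & whr k i = degen 1 f] /\
    [/\ face 1 h = kcomp i (leg0 P), face 0 h = idf (ts_ob P),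
        whl (leg0 P) h = degen 1 (leg0 P) & whl (leg1 P) h = k].
Proof.
move=> cP.
have [|i [i1 i0 ik]] := degenerate_lift (c := f) (b := idf B) cP.
  by rewrite kcomp_idl kcomp_idr.
rewrite kcomp_idl in ik.
have [||h [h1 h0 hk]] := comma_lift cP (w := prism min_homo k) (c := k) (b := degen 1 (leg0 P)).
- rewrite /whl kcomp_degen -(comma_src cP) /= /degen /face -act_comp; by congr act; mono_small.
- rewrite /whl comp_idl -[RHS]act_id /=; by congr act; mono_small.
exists i, h; split=> //; split=> //.
- apply: (comma_uniq cP) => [||m u t].
  + by rewrite /face whl_act h1 -/(face 1 k) (comma_src cP) whl0 compA i1.
  + by rewrite /face whl_act h0 act_degen degen0 whl0 compA i0 kcomp_idl.
  + rewrite -act_comp hk -[kcomp i _]degen0 act_degen -/(whr _ _) whr_act whr_kcomp ik.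
    rewrite /whr kcomp_degen act_degen -(comma_src cP) /= /degen /face -act_comp; congr act.
    by mono_square u t.
- apply: (comma_uniq cP) => [||m u t].
  + by rewrite /face whl_act h1 -/(face 0 k) (comma_tgt cP) whl0 kcomp_idl kcomp_idr.
  + by rewrite /face whl_act h0 act_degen degen0 whl0 kcomp_idr.
  + rewrite -act_comp hk -[idf _]degen0 act_degen comp_idr /=; congr act.
    by mono_square u t.
Qed.

(** * The three bijections *)

Lemma covariant_comma_cells (A B : K) (f g : functor A B) :
  exists F : cell2 f g -> cell (idf A) (idf B) (ts_comma (idf B) f) (ts_comma (idf B) g),
    bijective F /\ forall t a, cell2_rep t a -> forall e, cell_rep (F t) e <->
      over (idf A) (idf B) (ts_comma (idf B) f) (ts_comma (idf B) g) e /\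
      composite (comma_cell (idf B) f) (whr a (comma_p1 (idf B) f)) (whr (comma_cell (idf B) g) e).
Proof.
apply: (cells_of_2cells (H := fun a => composite _ (whr a _)) (comma_comma (idf B) g)).
rewrite !kcomp_idl.
have [i [h [[i1 i0 ik] [h1 h0 hp hs]]]] := comma_reflection (comma_comma (idf B) f).
exact: (reflection_transposition i1 hp _ h1 h0 i0 hs ik).
Qed.

Lemma arrow_cells (A B : K) (f g : functor A B) :
  exists F : cell2 f g -> cell g f (ts_arrow A) (ts_arrow B),
    bijective F /\ forall t a, cell2_rep t a -> forall e, cell_rep (F t) e <->
      over g f (ts_arrow A) (ts_arrow B) e /\
      composite (whl f (arrow_cell A)) (whr a (arrow_p1 A)) (whr (arrow_cell B) e).
Proof.
apply: (cells_of_2cells (H := fun a => composite _ (whr a _)) (arrow_comma B)); rewrite !kcomp_idl.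
have [i [h [[i1 i0 ik] [h1 h0 hp hs]]]] := comma_reflection (arrow_comma A).
rewrite -arrow_leg1; apply: (reflection_transposition i1 hp _ h1 h0).
- by rewrite -compA i0 kcomp_idr.
- by rewrite whl_kcomp hs.
- by rewrite -whl_whr ik /whl kcomp_degen kcomp_idr.
Qed.

Lemma contravariant_comma_cells (A B : K) (f g : functor A B) :
  exists F : cell2 f g -> cell (idf B) (idf A) (ts_comma g (idf B)) (ts_comma f (idf B)),
    bijective F /\ forall t a, cell2_rep t a -> forall e, cell_rep (F t) e <->
      over (idf B) (idf A) (ts_comma g (idf B)) (ts_comma f (idf B)) e /\
      composite (whr a (comma_p0 g (idf B))) (comma_cell g (idf B)) (whr (comma_cell f (idf B)) e).
Proof.
apply: (cells_of_2cells (H := fun a => composite (whr a _) _) (comma_comma f (idf B))).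
rewrite !kcomp_idl.
have [i [h [[i0 i1 ik] [h1 h0 hp hs]]]] := comma_coreflection (comma_comma g (idf B)).
exact: (coreflection_transposition i0 hp _ h1 h0 i1 hs ik).
Qed.

Lemma over_idf (A B : K) (E : two_sided A B) : over (idf A) (idf B) E E (idf (ts_ob E)).
Proof. by split; rewrite kcomp_idl kcomp_idr. Qed.

Lemma over_comp (A B C D M N : K) (u : functor A C) (v : functor B D) (u' : functor C M)
    (v' : functor D N) (E : two_sided A B) (P : two_sided C D) (Q : two_sided M N)
    (e : functor (ts_ob E) (ts_ob P)) (e' : functor (ts_ob P) (ts_ob Q)) :
  over u v E P e -> over u' v' P Q e' ->
  over (kcomp u' u) (kcomp v' v) E Q (kcomp e' e).
Proof.
move=> [e1 e0] [e1' e0'].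
by split; rewrite compA ?e1' ?e0' -compA ?e1 ?e0 compA.
Qed.

End Representability.

(* First block: bijectivity. Second block: each bijection is the canonical one, given by
   pasting with the comma 2-cells. Third block: functoriality, for identities and for
   vertical (first and third bijection) and horizontal (second) composition. *)
Theorem lemma4p4p11 (K : cosmos) :
  exists (Phi : forall (A B : K) (f g : functor A B), cell2 f g ->
            cell (idf A) (idf B) (ts_comma (idf B) f) (ts_comma (idf B) g))
         (Psi : forall (A B : K) (f g : functor A B), cell2 f g ->
            cell g f (ts_arrow A) (ts_arrow B))
         (Chi : forall (A B : K) (f g : functor A B), cell2 f g ->
            cell (idf B) (idf A) (ts_comma g (idf B)) (ts_comma f (idf B))),
  (forall (A B : K) (f g : functor A B),
     [/\ bijective (Phi A B f g), bijective (Psi A B f g) & bijective (Chi A B f g)])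
  /\
  (forall (A B : K) (f g : functor A B) (t : cell2 f g) (a : Map A B 1), cell2_rep t a ->
     [/\ forall e, cell_rep (Phi A B f g t) e ->
           composite (comma_cell (idf B) f) (whr a (comma_p1 (idf B) f))
                     (whr (comma_cell (idf B) g) e),
         forall e, cell_rep (Psi A B f g t) e ->
           composite (whl f (arrow_cell A)) (whr a (arrow_p1 A))
                     (whr (arrow_cell B) e)
       & forall e, cell_rep (Chi A B f g t) e ->
           composite (whr a (comma_p0 g (idf B))) (comma_cell g (idf B))
                     (whr (comma_cell f (idf B)) e)])
  /\
  [/\ forall (A B : K) (f : functor A B) (t : cell2 f f), cell2_rep t (degen 1 f) ->
        cell_rep (Phi A B f f t) (idf (comma (idf B) f))
        /\ cell_rep (Chi A B f f t) (idf (comma f (idf B))),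
      forall (A : K) (t : cell2 (idf A) (idf A)), cell2_rep t (degen 1 (idf A)) ->
        cell_rep (Psi A A (idf A) (idf A) t) (idf (arrow A)),
      forall (A B : K) (f g h : functor A B)
             (s : cell2 f g) (t : cell2 g h) (r : cell2 f h) (a b c : Map A B 1),
        cell2_rep s a -> cell2_rep t b -> cell2_rep r c -> composite a b c ->
        (forall d e, cell_rep (Phi A B f g s) d -> cell_rep (Phi A B g h t) e ->
           cell_rep (Phi A B f h r) (kcomp e d))
        /\ (forall d e, cell_rep (Chi A B f g s) d -> cell_rep (Chi A B g h t) e ->
              cell_rep (Chi A B f h r) (kcomp d e))
    & forall (A B C : K) (f g : functor B C) (h k : functor A B)
             (s : cell2 f g) (t : cell2 h k) (r : cell2 (kcomp f h) (kcomp g k))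
             (a : Map B C 1) (b : Map A B 1),
        cell2_rep s a -> cell2_rep t b -> cell2_rep r (kcomp a b) ->
        forall d e, cell_rep (Psi B C f g s) d -> cell_rep (Psi A B h k t) e ->
          cell_rep (Psi A C (kcomp f h) (kcomp g k) r) (kcomp d e)].
Proof.
exists (fun A B f g => sval (cid (covariant_comma_cells f g))).
exists (fun A B f g => sval (cid (arrow_cells f g))).
exists (fun A B f g => sval (cid (contravariant_comma_cells f g))).
split; last split.
- by move=> A B f g; split; [case: (cid (covariant_comma_cells f g)) => F []
    | case: (cid (arrow_cells f g)) => F [] | case: (cid (contravariant_comma_cells f g)) => F []].
- move=> A B f g t a ta; split=> e.
  + by case: cid => F [_ FE] /= /(FE _ _ ta) [].
  + by case: cid => F [_ FE] /= /(FE _ _ ta) [].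
  + by case: cid => F [_ FE] /= /(FE _ _ ta) [].
split.
- move=> A B f t tf; split; case: cid => F [_ FE] /=; apply/(FE _ _ tf); split;
    try exact: over_idf; rewrite /whr comp_idr kcomp_degen.
  + by apply: composite_idr; rewrite (comma_tgt (comma_comma (idf B) f)).
  + by apply: composite_idl; rewrite (comma_src (comma_comma f (idf B))).
- move=> A t tf; case: cid => F [_ FE] /=; apply/(FE _ _ tf); split; first exact: over_idf.
  rewrite /whr /whl comp_idr comp_idl kcomp_degen kcomp_idl.
  by apply: composite_idr; rewrite (comma_tgt (arrow_comma A)) arrow_leg1 kcomp_idl.
- move=> A B f g h s t r a b c sa tb rc abc; split=> d e; case: cid => F [_ FE] /=;
    case: cid => F' [_ F'E] /=; case: cid => F'' [_ F''E] /=.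
  + move=> /(FE _ _ sa) [od cd] /(F'E _ _ tb) [oe ce]; apply/(F''E _ _ rc); split.
      by have := over_comp od oe; rewrite !kcomp_idl.
    have p1d : kcomp (comma_p1 (idf B) g) d = comma_p1 (idf B) f by rewrite od.1 kcomp_idl.
    have := composite_whr d ce; rewrite -(whr_kcomp b) -(whr_kcomp (comma_cell _ h)) p1d => ce'.
    exact: (composite_assocr (@map_qcat K _ _) cd (composite_whr _ abc) ce').
  + move=> /(FE _ _ sa) [od cd] /(F'E _ _ tb) [oe ce]; apply/(F''E _ _ rc); split.
      by have := over_comp oe od; rewrite !kcomp_idl.
    have p0e : kcomp (comma_p0 g (idf B)) e = comma_p0 h (idf B) by rewrite oe.2 kcomp_idl.
    have := composite_whr e cd; rewrite -(whr_kcomp a) -(whr_kcomp (comma_cell f _)) p0e => cd'.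
    exact: (composite_assocl (@map_qcat K _ _) (composite_whr _ abc) ce cd').
- move=> A B C f g h k s t r a b sa tb rc d e; case: cid => F [_ FE] /=;
    case: cid => F' [_ F'E] /=; case: cid => F'' [_ F''E] /=.
  move=> /(FE _ _ sa) [od cd] /(F'E _ _ tb) [oe ce]; apply/(F''E _ _ rc); split.
    exact: over_comp oe od.
  have p1e : kcomp (arrow_p1 B) e = kcomp k (arrow_p1 A) by rewrite -!arrow_leg1 oe.1.
  have := composite_whr e cd.
  rewrite -(whr_kcomp a) -(whr_kcomp (arrow_cell C)) p1e (whr_kcomp a) => cd'.
  have := composite_whl f ce; rewrite !whl_whr -whl_kcomp => ce'.
  have [[[b1 b0] _] [[a1 a0] _]] := (tb, sa).
  have := composite_whr (arrow_p1 A) (composite_whl_whr a b); rewrite a1 b0 => ab.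
  exact: (composite_assocr (@map_qcat K _ _) ce' ab cd').
Qed.
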